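(* Let $n\geq 1$ and let $\mathrm{Aut}_{\mathrm{hol}}(\mathbb C^n)$ denote the group of all biholomorphic maps $F:\mathbb C^n\to\mathbb C^n$. For $F\in \mathrm{Aut}_{\mathrm{hol}}(\mathbb C^n)$ put $\Theta(F)=DF(0)^{-1}(F-F(0))$, i.e. $\Theta(F)(z)=DF(0)^{-1}(F(z)-F(0))$, and define $$\mathfrak{X}^n(F)=\Big(F(0),\ DF(0),\ L\big(\log\|\Theta(F)\|\big)\Big)\in \mathbb C^n\times GL(n,\mathbb C)\times \mathfrak{L}^n(PSH),$$ where the third component is the Levi matrix of the function $z\mapsto \log\|\Theta(F)(z)\|$ on $\mathbb C^n\setminus\{0\}$. Then the map $\mathfrak{X}^n:\mathrm{Aut}_{\mathrm{hol}}(\mathbb C^n)\to \mathbb C^n\times GL(n,\mathbb C)\times \mathfrak{L}^n(PSH)$ is injective. Equivalently: if $F,G\in\mathrm{Aut}_{\mathrm{hol}}(\mathbb C^n)$ satisfy $F(0)=G(0)$, $DF(0)=DG(0)$, and $L(\log\|\Theta(F)\|)=L(\log\|\Theta(G)\|)$ on $\mathbb C^n\setminus\{0\}$, then $F=G$.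
   Context: $\|\cdot\|$ is the standard Hermitian (Euclidean) norm on $\mathbb C^n$. For a real-valued $C^2$ function $g$ on an open subset of $\mathbb C^n$, its Levi matrix (complex Hessian) is the Hermitian $n\times n$ matrix $L(g)=\big(\partial^2 g/\partial z_i\partial\bar z_j\big)_{i,j}$; $g$ is plurisubharmonic if $L(g)\ge 0$ everywhere and pluriharmonic if $L(g)=0$ everywhere. $\mathfrak{L}^n(PSH)$ denotes the set of Levi matrices $L(g)$ of real-analytic plurisubharmonic functions $g$ defined on $\mathbb C^n\setminus\{0\}$, viewed as a subset of the real-analytic maps $\mathbb C^n\setminus\{0\}\to\mathbb C^{n\times n}$. (Note $\Theta(F)(0)=0$, $D\Theta(F)(0)=I$ and $\Theta(F)$ is injective, so $\log\|\Theta(F)\|$ is a real-analytic plurisubharmonic function on $\mathbb C^n\setminus\{0\}$.) *)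

(* Defs.v *)
From HB Require Import structures.
From mathcomp Require Import all_boot all_order all_algebra.
From mathcomp Require Import all_classical all_reals all_analysis.
From mathcomp Require Import complex.
Set Implicit Arguments. Unset Strict Implicit. Unset Printing Implicit Defensive.
Import Order.TTheory GRing.Theory Num.Theory.
Import numFieldTopology.Exports numFieldNormedType.Exports.
Local Open Scope ring_scope.
Local Open Scope complex_scope.

(* C^n is modelled as row vectors 'rV[R[i]]_n, with R : realType and
   R[i] = complex R.  This is a normedModType over the numFieldType R[i],
   so MathComp-Analysis' Frechet differentiability over R[i] is complex
   (holomorphic) differentiability. *)
Definition Cc (R : realType) : numFieldType := R[i].
Notation Cn R n := 'rV[Cc R]_n.

Definition holomorphic (R : realType) (n : nat) (F : Cn R n -> Cn R n) :=
  forall z : Cn R n, differentiable F z.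

Definition biholomorphic (R : realType) (n : nat) (F : Cn R n -> Cn R n) :=
  exists G : Cn R n -> Cn R n,
    [/\ holomorphic F, holomorphic G, cancel F G & cancel G F].

(* the complex Jacobian DF(z) as a matrix (row-vector convention: dF(z) h = h *m DF z) *)
Definition Dmx (R : realType) (n : nat) (F : Cn R n -> Cn R n) (z : Cn R n)
  : 'M[Cc R]_n := lin1_mx ('d F z).

Definition Theta (R : realType) (n : nat) (F : Cn R n -> Cn R n) : Cn R n -> Cn R n :=
  fun z => (F z - F 0) *m invmx (Dmx F 0).

Definition hnorm2 (R : realType) (n : nat) (z : Cn R n) : R :=
  \sum_(j < n) (complex.Re (z 0 j) ^+ 2 + complex.Im (z 0 j) ^+ 2).

Definition hnorm (R : realType) (n : nat) (z : Cn R n) : R := Num.sqrt (hnorm2 z).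

Definition D2 (R : realType) (n : nat) (g : Cn R n -> R) (a b z : Cn R n) : R :=
  derive1 (fun s : R => derive1 (fun t : R => g (z + (s%:C) *: a + (t%:C) *: b)) 0) 0.

Definition ej {R : realType} {n : nat} (j : 'I_n) : Cn R n := \row_k (k == j)%:R.

(* Levi matrix  L(g)(z)_{ij} = d^2 g / dz_i d\bar z_j (z), with
   d/dz_i = (d/dx_i - i d/dy_i)/2 and d/d\bar z_j = (d/dx_j + i d/dy_j)/2 *)
Definition Levi (R : realType) (n : nat) (g : Cn R n -> R) (z : Cn R n) : 'M[Cc R]_n :=
  \matrix_(i < n, j < n)
    ((D2 g (ej i) (ej j) z + D2 g ('i *: ej i) ('i *: ej j) z)%:C / 4%:R
     + 'i * (D2 g (ej i) ('i *: ej j) z - D2 g ('i *: ej i) (ej j) z)%:C / 4%:R).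

Definition logTheta (R : realType) (n : nat) (F : Cn R n -> Cn R n) : Cn R n -> R :=
  fun z => ln (hnorm (Theta F z)).

(* Main.v *)
Require Import Defs.
From HB Require Import structures.
From mathcomp Require Import all_boot all_order all_algebra.
From mathcomp Require Import all_classical all_reals all_analysis.
From mathcomp Require Import complex ring lra.
Import Order.TTheory GRing.Theory Num.Theory.
Import numFieldTopology.Exports numFieldNormedType.Exports.
Local Open Scope classical_set_scope.
Local Open Scope ring_scope.

(** Put [f = Theta F] and [g = Theta G]. The Levi matrix of [log |f|] is half the
    pullback of the Fubini-Study form: on a vector [v], with [u = v Df], it takes
    the value [(|u|^2 |f|^2 - |<u, f>|^2) / (2 |f|^4)], which by the equality case
    of Cauchy-Schwarz vanishes exactly when [u] is a multiple of [f].
    Fix [w <> 0] and follow the entire curve [c t = f (g^-1 (t w))]. Along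
    [g^-1 (t w)] the form of [g] vanishes on the velocity, hence so does that of
    [f], so that [c' t] is a multiple of [c t]; as [c] starts at 0 with velocity
    [w], it stays in the line [C w], i.e. [c t = alpha t w] with [alpha] entire.
    Exchanging [f] and [g] gives an entire left inverse of [alpha], so that
    [t / alpha t] is entire, has linear growth and no zeros; it is therefore the
    constant 1, and [f = g].

    The regularity needed (complex derivatives of entire maps are again complex
    differentiable) all follows from Cauchy's estimate [|h' a| <= 2 M / r], where
    [M] bounds [|h|] on the circle of radius [r] around [a]. *)

Set Implicit Arguments. Unset Strict Implicit. Unset Printing Implicit Defensive.

(** Equality of the Levi matrices says that [log |f| - log |g|] is pluriharmonic off 0. The argument
    does not integrate this relation; it uses only null vectors, which are visible for [g]: its
    curve is sent to [t w], whose velocity [w] is parallel to its position.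

    The relation [c' t = l * c t] is obtained separately for each [t <> 0], with a factor [l] that
    behaves like [1 / t] at 0, where the initial value sits; uniqueness for linear differential
    equations does not apply there. The way out is a quotient of squared norms whose derivative
    along a ray vanishes whatever [l] is, and whose limit at 0 is read off from [c' 0 = w].

    For [n = 1] every direction is null and collinearity is automatic, so the Levi form alone cannot
    pin down [alpha]; its left inverse does. Continuity of that inverse at 0 keeps [alpha] away from
    0 outside a disc, whence the linear growth, and an affine function without zeros is constant.
    Its value is 1 because [Theta] normalises the derivative at 0. *)

Local Notation cn := ComplexField.Normc.normc.

(** * Derivatives in epsilon-delta form *)

Section IsDeriveEpsDelta.
Variable K : numFieldType.
Implicit Types (f : K -> K) (x d : K).

(** Stated over any [numFieldType], so that it serves real functions and complex functions alike;
    multiplied out, the estimate includes [t = 0]. *)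
Lemma is_derive_epsdelta f x d :
  is_derive x 1 f d <->
  forall e, 0 < e -> exists2 r, 0 < r & forall t, `|t| < r ->
    `|f (x + t) - f x - d * t| <= e * `|t|.
Proof.
have eq_quot t : t != 0 ->
    d - t^-1 * (f (x + t) - f x) = - (t^-1 * (f (x + t) - f x - d * t)).
  by move=> t0; rewrite [in RHS]mulrBr (mulrC d) mulKf// opprB.
split=> [[fx <-] e e0|H].
  move: fx; rewrite /derivable => /cvgrPdist_le /(_ e e0).
  rewrite -/(derive f x 1) near_withinE => /nbhs_ballP [r r0 Hr].
  exists r => // t tr; have [->|t0] := eqVneq t 0.
    by rewrite addr0 subrr mulr0 subr0 !normr0 mulr0.
  have := Hr t; rewrite -ball_normE/= sub0r normrN => /(_ tr t0).
  rewrite [t *: 1]mulr1 (addrC t x) [_ *: _]/(_ * _).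
  set d' := derive f x 1 => le.
  have -> : f (x + t) - f x - d' * t = - (t * (d' - t^-1 * (f (x + t) - f x))).
    by rewrite mulrBr mulVKf// opprB mulrC.
  by rewrite normrN normrM mulrC ler_wpM2r.
have : (fun h => h^-1 *: (f (h *: 1 + x) - f x)) @ 0^' --> d.
  apply/cvgrPdist_le => e e0; have [r r0 Hr] := H e e0.
  rewrite near_withinE; apply/nbhs_ballP; exists r => //= t.
  rewrite -ball_normE/= sub0r normrN => tr t0.
  rewrite [t *: 1]mulr1 (addrC t x) [_ *: _]/(_ * _) eq_quot//.
  by rewrite normrN normrM normfV ler_pdivrMl ?normr_gt0// [_ * e]mulrC Hr.
move=> cv; apply: DeriveDef; first by apply/cvg_ex; exists d.
by apply: cvg_lim => //; exact: norm_hausdorff.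
Qed.

End IsDeriveEpsDelta.

(** * The complex modulus and complex derivatives *)

Section Complex.
Variable R : realType.
Implicit Types (z w : Cc R) (h k : Cc R -> Cc R).

Lemma normCc (z : Cc R) : `|z| = (cn z)%:C%C.
Proof. by rewrite {1}/Num.norm /=; case: z. Qed.

Lemma cn_ge0 z : 0 <= cn z. Proof. by case: z => a b; exact: sqrtr_ge0. Qed.

Lemma cn_sqr z : cn z ^+ 2 = complex.Re z ^+ 2 + complex.Im z ^+ 2.
Proof. by case: z => a b /=; rewrite sqr_sqrtr// addr_ge0// sqr_ge0. Qed.

Lemma cn0 : cn (0 : Cc R) = 0. Proof. exact: ComplexField.Normc.normc0. Qed.

Lemma cn_eq0 z : (cn z == 0) = (z == 0).
Proof.
by apply/eqP/eqP => [/ComplexField.Normc.eq0_normc//|->]; exact: cn0.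
Qed.

Lemma cn_gt0 z : (0 < cn z) = (z != 0).
Proof. by rewrite lt0r cn_eq0 cn_ge0 andbT. Qed.

Lemma cnM z w : cn (z * w) = cn z * cn w.
Proof. exact: ComplexField.Normc.normcM. Qed.

Lemma cnV z : cn z^-1 = (cn z)^-1.
Proof. exact: ComplexField.Normc.normcV. Qed.

Lemma cnN z : cn (- z) = cn z.
Proof. exact: normcN. Qed.

Lemma cnD z w : cn (z + w) <= cn z + cn w.
Proof. exact: le_normcD. Qed.

Lemma cnB z w : cn (z - w) <= cn z + cn w.
Proof. by rewrite -(cnN w) cnD. Qed.

Lemma cn_real (x : R) : cn x%:C%C = `|x|.
Proof. by rewrite /= expr0n /= addr0 sqrtr_sqr. Qed.

Lemma cn_i : cn 'i%C = 1 :> R.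
Proof. by rewrite /= expr0n /= add0r expr1n sqrtr1. Qed.

Lemma cn_Re z : `|complex.Re z| <= cn z.
Proof.
case: z => a b /=; rewrite -sqrtr_sqr ler_wsqrtr// lerDl; exact: sqr_ge0.
Qed.

Lemma cn_Im z : `|complex.Im z| <= cn z.
Proof.
case: z => a b /=; rewrite -sqrtr_sqr ler_wsqrtr// lerDr; exact: sqr_ge0.
Qed.

Lemma cn_le_ReIm z : cn z <= `|complex.Re z| + `|complex.Im z|.
Proof.
rewrite [z in cn z]complexE; apply: le_trans (cnD _ _) _.
by rewrite cnM cn_i mul1r !cn_real.
Qed.

Lemma cReD z w : complex.Re (z + w) = complex.Re z + complex.Re w.
Proof. by case: z w => a b []. Qed.
Lemma cImD z w : complex.Im (z + w) = complex.Im z + complex.Im w.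
Proof. by case: z w => a b []. Qed.
Lemma cReN z : complex.Re (- z) = - complex.Re z.
Proof. by case: z. Qed.
Lemma cImN z : complex.Im (- z) = - complex.Im z.
Proof. by case: z. Qed.
Lemma cReM z w :
  complex.Re (z * w) = complex.Re z * complex.Re w - complex.Im z * complex.Im w.
Proof. by case: z w => a b []. Qed.
Lemma cImM z w :
  complex.Im (z * w) = complex.Re z * complex.Im w + complex.Im z * complex.Re w.
Proof. by case: z w => a b []. Qed.

Lemma real_complexD (x y : R) : (x + y)%:C%C = x%:C%C + y%:C%C :> Cc R.
Proof. exact: rmorphD. Qed.

Lemma complex_gt0 (e : Cc R) : 0 < e -> exists2 r : R, 0 < r & e = r%:C%C.
Proof.
case: e => a b; rewrite ltcE /= => /andP[/eqP -> a0].
by exists a.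
Qed.

(** The norm of [Cc R] takes values in [Cc R] itself, where positive elements are real. Epsilon and
    modulus are moved to [R] here, so that later estimates are real inequalities. *)
Lemma hderP h (a d : Cc R) :
  is_derive a 1 h d <->
  forall e : R, 0 < e -> exists2 r : R, 0 < r & forall t, cn t < r ->
    cn (h (a + t) - h a - d * t) <= e * cn t.
Proof.
split=> [/is_derive_epsdelta H e e0|H].
  have [|r r0 Hr] := H e%:C%C; first by rewrite ltcR.
  have [s s0 rs] := complex_gt0 r0; exists s => // t ts.
  have := Hr t; rewrite rs !normCc ltcR => /(_ ts).
  by rewrite -[_ * _%:C%C]rmorphM lecR.
apply/is_derive_epsdelta => e /complex_gt0 [r r0 ->].
have [s s0 Hs] := H _ r0; exists s%:C%C; first by rewrite ltcR.
by move=> t; rewrite !normCc ltcR => /Hs; rewrite -[_ * _%:C%C]rmorphM lecR.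
Qed.

Lemma hder_comp h k (a d e : Cc R) :
  is_derive (h a) 1 k e -> is_derive a 1 h d -> is_derive a 1 (k \o h) (e * d).
Proof.
move=> /hderP Hk /hderP Hh; apply/hderP => x x0.
have d1 : 0 < cn d + 1 by rewrite ltr_wpDl ?cn_ge0.
have e1 : 0 < cn e + 1 by rewrite ltr_wpDl ?cn_ge0.
have x2 : 0 < x / 2 by rewrite divr_gt0.
have [r r0 Hr] := Hk _ (divr_gt0 x2 d1).
have [s s0 Hs] := Hh 1 ltr01.
have [s' s'0 Hs'] := Hh _ (divr_gt0 x2 e1).
exists (Num.min (r / (cn d + 1)) (Num.min s s')).
  by rewrite !lt_min divr_gt0 ?s0.
move=> t; rewrite !lt_min => /and3P[tr ts ts'] /=.
have {}Hs := Hs t ts; have {}Hs' := Hs' t ts'.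
set y := h (a + t) - h a.
have yt : cn y <= (cn d + 1) * cn t.
  rewrite -[y](subrK (d * t)); apply: le_trans (cnD _ _) _.
  by rewrite cnM mulrDl [leRHS]addrC lerD.
have yr : cn y < r by apply: le_lt_trans yt _; rewrite mulrC -ltr_pdivlMr.
have := Hr y yr; rewrite {1}/y [h a + _]addrC subrK => {}Hr.
have -> : k (h (a + t)) - k (h a) - e * d * t =
    (k (h (a + t)) - k (h a) - e * y) + e * (y - d * t).
  by ring.
apply: le_trans (cnD _ _) _; rewrite [x]splitr mulrDl lerD//.
  apply: le_trans Hr _.
  apply: le_trans (ler_wpM2l _ yt) _; first by rewrite divr_ge0 ?divr_ge0// ltW.
  by rewrite mulrA divfK// gt_eqF.
rewrite cnM; apply: le_trans (ler_wpM2l (cn_ge0 e) Hs') _.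
rewrite mulrA ler_wpM2r ?cn_ge0// mulrA ler_pdivrMr// mulrC ler_wpM2l ?lerDl//.
by rewrite divr_ge0 // ltW.
Qed.

End Complex.

(** * Curves in the complex plane and Goursat's lemma *)

Section RealPrimitive.
Variable R : realType.
Implicit Types (u U : R -> R).

Lemma ex_primitive_itv u (N : R) : continuous u ->
  exists U : R -> R, forall x : R, `|x| < N -> is_derive x 1 U (u x).
Proof.
move=> cu; exists (fun x => \int[lebesgue_measure]_(t in `[-N, x]) u t)%R => x.
rewrite ltr_norml => /andP[Nx xN].
have iu : lebesgue_measure.-integrable `[-N, N] (EFin \o u).
  apply: continuous_compact_integrable; first exact: segment_compact.
  by apply: continuous_subspaceT.
have [] := @continuous_FTC1_closed R u (-N) x N xN iu Nx (cu x).
by move=> dF; rewrite derive1E => Fx; apply: DeriveDef.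
Qed.

Lemma eq_derive_increment (u U V : R -> R) (a b : R) : a <= b ->
  (forall x : R, a <= x <= b -> is_derive x 1 U (u x)) ->
  (forall x : R, a <= x <= b -> is_derive x 1 V (u x)) -> U b - U a = V b - V a.
Proof.
move=> ab dU dV.
have dUV (x : R) : a <= x <= b -> is_derive x 1 (U - V) 0.
  by move=> /[dup] /dU ? /dV ?; rewrite -(subrr (u x)); exact: is_deriveB.
have [c _] : exists2 c, c \in `[a, b]%R & (U - V) b - (U - V) a = 0 * (b - a).
  apply: (@MVT_segment _ _ (fun=> 0)) => //.
    by move=> x /subset_itv_oo_cc; rewrite in_itv => /= /dUV  .
  by apply: derivable_within_continuous => x; rewrite in_itv => /= /dUV [].

rewrite mul0r !fctE => H; lra.
Qed.

(** Integration from [-n] gives a primitive on []-n, n[] only. Normalised at 0, these primitives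
    agree where they overlap, and so glue. *)
Lemma ex_primitive u : continuous u -> exists U : R -> R, forall x : R, is_derive x 1 U (u x).
Proof.
move=> cu; have /choice [F dF] := fun n : nat => @ex_primitive_itv u n%:R cu.
pose N (x : R) := (Num.truncn `|x|).+1.
have xN x : `|x| < (N x)%:R by rewrite truncnS_gt.
have FE (m n : nat) x : `|x| < m%:R -> `|x| < n%:R ->
    F m x - F m 0 = F n x - F n 0.
  move=> xm xn; have [x0|/ltW x0] := leP 0 x.
    have dFk (k : nat) y : `|x| < k%:R -> 0 <= y <= x -> is_derive y 1 (F k) (u y).
      move=> xk /andP[y0 yx]; apply/dF/(le_lt_trans _ xk).
      by rewrite !ger0_norm.
    by apply: (@eq_derive_increment u) => // y; exact: dFk.
  have dFk (k : nat) y : `|x| < k%:R -> x <= y <= 0 -> is_derive y 1 (F k) (u y).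
    move=> xk /andP[xy y0]; apply/dF/(le_lt_trans _ xk).
    by rewrite !ler0_norm// lerN2.
  apply: oppr_inj; rewrite !opprB.
  by apply: (@eq_derive_increment u) => // y; exact: dFk.
exists (fun x => F (N x) x - F (N x) 0) => x.
(* One more than [N x], so that a single primitive serves all points at distance less than 1 from
   [x]. *)
apply: (@near_eq_is_derive _ _ _ (fun y => F (N x).+1 y - F (N x).+1 0)).
- near=> y; apply: FE => //.
  have : `|y - x| < 1.
    by near: y; apply/nbhs_ballP; exists 1 => //= z; rewrite -ball_normE /= distrC.
  move=> yx; rewrite -[y](subrK x); apply: le_lt_trans (ler_normD _ _) _.
  by rewrite [ltRHS]mulrS ltrD.
- have dFx : is_derive x 1 (F (N x).+1) (u x).
    by apply: dF; apply: lt_trans (xN x) _; rewrite ltr_nat.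
  by rewrite -[u x]subr0; apply: is_deriveB.
Unshelve. all: by end_near. Qed.

End RealPrimitive.

(** * Complex-valued curves of a real variable *)

Section ComplexCurves.
Variable R : realType.
Implicit Types (U V : R -> Cc R) (x : R) (d e : Cc R) (h : Cc R -> Cc R).

(* [R[i]] carries no normed module structure over [R], so curves are
   differentiated componentwise. *)
Definition rder U x d :=
  is_derive x (1 : R) (fun t => complex.Re (U t)) (complex.Re d) /\
  is_derive x (1 : R) (fun t => complex.Im (U t)) (complex.Im d).

Lemma rder_eq U x d e : rder U x d -> d = e -> rder U x e.
Proof. by move=> H <-. Qed.

Lemma rderB U V x d e :
  rder U x d -> rder V x e -> rder (fun t => U t - V t) x (d - e).
Proof.
move=> [Ur Ui] [Vr Vi]; split.
  rewrite (_ : (fun t => _) = (fun t => complex.Re (U t)) - (fun t => complex.Re (V t))).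
    by rewrite cReD cReN; exact: is_deriveB.
  by apply/funext => t; rewrite cReD cReN.
rewrite (_ : (fun t => _) = (fun t => complex.Im (U t)) - (fun t => complex.Im (V t))).
  by rewrite cImD cImN; exact: is_deriveB.
by apply/funext => t; rewrite cImD cImN.
Qed.

Lemma rderZ (c : Cc R) U x d : rder U x d -> rder (fun t => c * U t) x (c * d).
Proof.
move=> [Ur Ui]; split.
  rewrite (_ : (fun t => _) = complex.Re c *: (fun t => complex.Re (U t))
      - complex.Im c *: (fun t => complex.Im (U t))).
    by rewrite cReM; apply: is_deriveB; exact: is_deriveZ.
  by apply/funext => t; rewrite cReM.
rewrite (_ : (fun t => _) = complex.Re c *: (fun t => complex.Im (U t))
      + complex.Im c *: (fun t => complex.Re (U t))).
  by rewrite cImM; apply: is_deriveD; exact: is_deriveZ.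
by apply/funext => t; rewrite cImM.
Qed.

(** Every passage from complex to real derivatives goes through this chain rule: sides of
    rectangles, segments and rays all have the form [a + t b]. *)
Lemma rder_slice h (a b d : Cc R) x :
  is_derive (a + x%:C%C * b) (1 : Cc R) h d ->
  rder (fun t => h (a + t%:C%C * b)) x (d * b).
Proof.
move=> /hderP H.
suff H2 (e : R) : 0 < e -> exists2 r : R, 0 < r & forall t : R, `|t| < r ->
    cn (h (a + (x + t)%:C%C * b) - h (a + x%:C%C * b) - d * b * t%:C%C) <= e * `|t|.
  split; apply/is_derive_epsdelta => e /H2 [r r0 Hr]; exists r => // t /Hr.
    apply: le_trans; apply: le_trans (cn_Re _).
    by rewrite !cReD !cReN [complex.Re (_ * _%:C%C)]cReM /= mulr0 subr0.
  apply: le_trans; apply: le_trans (cn_Im _).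
  by rewrite !cImD !cImN [complex.Im (_ * _%:C%C)]cImM /= mulr0 add0r.
move=> e0; have b1 : 0 < cn b + 1 by rewrite ltr_wpDl ?cn_ge0.
have [r r0 Hr] := H _ (divr_gt0 e0 b1).
exists (r / (cn b + 1)); first exact: divr_gt0.
move=> t tr; have tb : cn (t%:C%C * b) <= `|t| * (cn b + 1).
  by rewrite cnM cn_real ler_wpM2l// lerDl.
have -> : a + (x + t)%:C%C * b = a + x%:C%C * b + t%:C%C * b.
  by rewrite real_complexD mulrDl addrA.
have -> : d * b * t%:C%C = d * (t%:C%C * b) by ring.
have {}Hr := Hr (t%:C%C * b).
apply: le_trans (Hr _) _; first by apply: le_lt_trans tb _; rewrite -ltr_pdivlMr.
apply: le_trans (ler_wpM2l _ tb) _; first by rewrite divr_ge0// ltW.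
by rewrite mulrA mulrAC divfK ?gt_eqF.
Qed.

(* The factor 2 comes from treating real and imaginary parts separately. *)
Lemma rder_mvt U (u : R -> Cc R) (a b K : R) : a <= b ->
  (forall x, a <= x <= b -> rder U x (u x)) ->
  (forall x, a <= x <= b -> cn (u x) <= K) -> cn (U b - U a) <= 2 * K * (b - a).
Proof.
move=> ab dU uK; have ba : 0 <= b - a by rewrite subr_ge0.
have mvt (f g : R -> R) : (forall x, a <= x <= b -> is_derive x (1 : R) f (g x)) ->
    (forall x, a <= x <= b -> `|g x| <= K) -> `|f b - f a| <= K * (b - a).
  move=> df gK.
  have [c /[!in_itv]/= cab ->] : exists2 c, c \in `[a, b]%R & f b - f a = g c * (b - a).
    apply: MVT_segment => //.
      by move=> x /subset_itv_oo_cc; rewrite in_itv => /= /df.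
    by apply: derivable_within_continuous => x; rewrite in_itv => /= /df [].
  by rewrite normrM (ger0_norm ba) ler_wpM2r// gK.
apply: le_trans (cn_le_ReIm _) _; rewrite -mulrA mulrDl mul1r.
rewrite cReD cImD cReN cImN; apply: lerD.
  apply: (mvt (fun t => complex.Re (U t)) (fun x => complex.Re (u x))) => x /[dup] xab.
    by move=> /dU [].
  by move=> /uK; exact/le_trans/cn_Re.
apply: (mvt (fun t => complex.Im (U t)) (fun x => complex.Im (u x))) => x /[dup] xab.
  by move=> /dU [].
by move=> /uK; exact/le_trans/cn_Im.
Qed.

Lemma ex_rprimitive (u : R -> Cc R) : (forall x, exists d, rder u x d) ->
  exists U, forall x, rder U x (u x).
Proof.
move=> du.
have [|A dA] := @ex_primitive R (fun t => complex.Re (u t)).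
  by move=> x; have [d [[/derivable1_diffP/differentiable_continuous]]] := du x.
have [|B dB] := @ex_primitive R (fun t => complex.Im (u t)).
  by move=> x; have [d [_ [/derivable1_diffP/differentiable_continuous]]] := du x.
exists (fun x => (A x +i* B x)%C) => x; split; [exact: dA|exact: dB].
Qed.

(** Completeness of [R] in the form used twice below: for the limit point of a bisection, and for
    the limits of the real and imaginary parts of a Cauchy sequence. *)
Lemma nested_point (l r : nat -> R) : (forall m n, l m <= r n) ->
  exists X, forall n, l n <= X <= r n.
Proof.
move=> lr; pose S := [set l n | n in [set: nat]].
have hS : has_sup S.
  by split; [exists (l 0%N), 0%N|exists (r 0%N) => _ [n _ <-]].
exists (sup S) => n; apply/andP; split; first by apply: sup_upper_bound => //; exists n.
by apply: ge_sup => [|_ [m _ <-]//]; exists (l 0%N), 0%N.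
Qed.

End ComplexCurves.

(** * Goursat's lemma for rectangles *)

Section Goursat.
Variable R : realType.
Implicit Types (x y : R).

Lemma eq_ler x y : x = y -> x <= y. Proof. by move=> ->. Qed.

Definition cpt x y : Cc R := Complex x y.

Lemma cptE x y : cpt x y = x%:C%C + 'i%C * y%:C%C :> Cc R.
Proof. exact: (complexE (Complex x y)). Qed.

Lemma rder_hor (h : Cc R -> Cc R) (d : Cc R) x y :
  is_derive (cpt x y) (1 : Cc R) h d -> rder (fun t => h (cpt t y)) x d.
Proof.
have E t : cpt t y = 'i%C * y%:C%C + t%:C%C * (1 : Cc R) by rewrite cptE; ring.
rewrite E => /rder_slice; rewrite mulr1.
by under [X in rder X]eq_fun do rewrite -E.
Qed.

Lemma rder_ver (h : Cc R -> Cc R) (d : Cc R) x y :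
  is_derive (cpt x y) (1 : Cc R) h d -> rder (fun t => h (cpt x t)) y (d * 'i%C).
Proof.
have E t : cpt x t = x%:C%C + t%:C%C * ('i%C : Cc R) by rewrite cptE; ring.
rewrite E => /rder_slice.
by under [X in rder X]eq_fun do rewrite -E.
Qed.

Variables (H H' : Cc R -> Cc R) (U V : R -> R -> Cc R).
Hypothesis dH : forall z, is_derive z (1 : Cc R) H (H' z).
Hypothesis dU : forall y x, rder (U y) x (H (cpt x y)).
Hypothesis dV : forall x y, rder (V x) y (H (cpt x y)).

(* The integral of [H] along the boundary of [[a, b] x [c, d]], written with the
   antiderivatives [U y] and [V x] of [H] along horizontal and vertical lines. *)
Definition bdry (a b c d : R) : Cc R :=
  U c b - U c a + 'i%C * (V b d - V b c)
    - (U d b - U d a) - 'i%C * (V a d - V a c).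

Lemma quad_is_derive (p q P z : Cc R) :
  is_derive z (1 : Cc R) (fun z : Cc R => p * (z - P) + q / 2%:R * (z - P) ^+ 2)
    (p + q * (z - P)).
Proof.
apply/hderP => e e0; have q1 : 0 < cn (q / 2%:R : Cc R) + 1.
  by rewrite ltr_wpDl ?cn_ge0.
exists (e / (cn (q / 2%:R : Cc R) + 1)); first exact: divr_gt0.
move=> t te.
have -> : p * (z + t - P) + q / 2%:R * (z + t - P) ^+ 2
    - (p * (z - P) + q / 2%:R * (z - P) ^+ 2) - (p + q * (z - P)) * t
    = (q / 2%:R * t) * t by field.
rewrite cnM ler_wpM2r ?cn_ge0// cnM.
apply: (@le_trans _ _ ((cn (q / 2%:R : Cc R) + 1) * cn t)).
  by rewrite ler_wpM2r ?cn_ge0// lerDl.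
by rewrite mulrC -ler_pdivlMr// ltW.
Qed.

(* The first Taylor polynomial of [H] has an antiderivative [A], which
   contributes nothing to the boundary integral. *)
Lemma bdry_le_taylor (P : Cc R) (K a b c d : R) : a <= b -> c <= d ->
  (forall x y, a <= x <= b -> c <= y <= d ->
    cn (H (cpt x y) - (H P + H' P * (cpt x y - P))) <= K) ->
  cn (bdry a b c d) <= 4 * K * ((b - a) + (d - c)).
Proof.
move=> ab cd HK.
pose A (z : Cc R) : Cc R := H P * (z - P) + H' P / 2%:R * (z - P) ^+ 2.
have dA z : is_derive z (1 : Cc R) A (H P + H' P * (z - P)) by exact: quad_is_derive.
have hor y : c <= y <= d ->
    cn ((U y b - A (cpt b y)) - (U y a - A (cpt a y))) <= 2 * K * (b - a).
  move=> ycd; apply: (@rder_mvt R (fun x => U y x - A (cpt x y))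
    (fun x => H (cpt x y) - (H P + H' P * (cpt x y - P)))) => // x xab.
    by apply: rderB; [exact: dU|exact: rder_hor].
  exact: HK.
have ver x : a <= x <= b ->
    cn (('i%C * V x d - A (cpt x d)) - ('i%C * V x c - A (cpt x c))) <= 2 * K * (d - c).
  move=> xab; apply: (@rder_mvt R (fun y => 'i%C * V x y - A (cpt x y))
    (fun y => 'i%C * H (cpt x y) - (H P + H' P * (cpt x y - P)) * 'i%C)) => // y ycd.
    by apply: rderB; [apply: rderZ; exact: dV|exact: rder_ver].
  by rewrite [_ * 'i%C]mulrC -mulrBr cnM cn_i mul1r HK.
have -> : bdry a b c d =
    ((U c b - A (cpt b c)) - (U c a - A (cpt a c)))
    + (('i%C * V b d - A (cpt b d)) - ('i%C * V b c - A (cpt b c)))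
    - ((U d b - A (cpt b d)) - (U d a - A (cpt a d)))
    - (('i%C * V a d - A (cpt a d)) - ('i%C * V a c - A (cpt a c))).
  by rewrite /bdry; ring.
have h1 := hor c; have h2 := hor d; have v1 := ver a; have v2 := ver b.
move: h1 h2 v1 v2; rewrite !lexx ab cd => /(_ isT) h1 /(_ isT) h2 /(_ isT) v1 /(_ isT) v2.
apply: le_trans (cnB _ _) _; apply: le_trans (lerD (cnB _ _) v1) _.
apply: le_trans (lerD (lerD (cnD _ _) h2) (lexx _)) _.
apply: le_trans (lerD (lerD (lerD h1 v2) (lexx _)) (lexx _)) _.
by apply: eq_ler; ring.
Qed.

(** The inner sides are traversed twice in opposite directions, so the integrals over the four
    quarters add up to the whole. *)
Lemma bdry_quarter (a b c d e : R) (m := (a + b) / 2) (k := (c + d) / 2) :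
  4 * e <= cn (bdry a b c d) ->
  [\/ e <= cn (bdry a m c k), e <= cn (bdry m b c k),
      e <= cn (bdry a m k d) | e <= cn (bdry m b k d)].
Proof.
have -> : bdry a b c d =
    bdry a m c k + bdry m b c k + bdry a m k d + bdry m b k d.
  by rewrite /bdry; ring.
move=> le4.
have [?|l1] := leP e (cn (bdry a m c k)); first by constructor 1.
have [?|l2] := leP e (cn (bdry m b c k)); first by constructor 2.
have [?|l3] := leP e (cn (bdry a m k d)); first by constructor 3.
have [?|l4] := leP e (cn (bdry m b k d)); first by constructor 4.
have t1 := cnD (bdry a m c k + bdry m b c k + bdry a m k d) (bdry m b k d).
have t2 := cnD (bdry a m c k + bdry m b c k) (bdry a m k d).
have t3 := cnD (bdry a m c k) (bdry m b c k).
by exfalso; lra.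
Qed.

(** Bisection gives nested rectangles with sides [p * w n] and [q * w n], where [w n] is [2 ^ -n],
    and boundary integral at least [eta * w n ^+ 2]. Differentiability of [H] at their common point
    bounds the same integral by an arbitrarily small multiple of [w n ^+ 2]. *)
Lemma goursat (a b c d : R) : a <= b -> c <= d -> bdry a b c d = 0.
Proof.
move=> ab cd; apply/eqP; rewrite -cn_eq0 eq_le cn_ge0 andbT.
set eta := cn _; pose p := b - a; pose q := d - c.
have p0 : 0 <= p by rewrite subr_ge0.
have q0 : 0 <= q by rewrite subr_ge0.
pose w n : R := 2^-1 ^+ n.
have w0 n : 0 < w n by rewrite exprn_gt0// invr_gt0.
have wS n : w n = 2 * w n.+1 by rewrite /w exprS mulrA divff// mul1r.
pose S (n : nat) (z : R * R) :=
  eta * w n ^+ 2 <= cn (bdry z.1 (z.1 + p * w n) z.2 (z.2 + q * w n)).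
(* Conditional on [S], with an arbitrary pair otherwise, so that [choice] yields a total function to
   iterate. *)
have step (nz : nat * (R * R)) : exists z' : R * R, S nz.1 nz.2 ->
    [/\ S nz.1.+1 z', nz.2.1 <= z'.1, z'.1 + p * w nz.1.+1 <= nz.2.1 + p * w nz.1,
      nz.2.2 <= z'.2 & z'.2 + q * w nz.1.+1 <= nz.2.2 + q * w nz.1].
  case: nz => n [x y] /=.
  have [Sn|nS] := pselect (S n (x, y)); last by exists 0.
  have pw : 0 <= p * w n.+1 by rewrite mulr_ge0// ltW.
  have qw : 0 <= q * w n.+1 by rewrite mulr_ge0// ltW.
  have E (u v : R) : (u + (u + v * w n)) / 2 = u + v * w n.+1 by rewrite (wS n); field.
  have E2 (u v : R) : u + v * w n = u + v * w n.+1 + v * w n.+1 by rewrite (wS n); ring.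
  have := @bdry_quarter x (x + p * w n) y (y + q * w n) (eta * w n.+1 ^+ 2).
  rewrite !E => /(_ _); case.
  - by apply: le_trans Sn; apply: eq_ler; rewrite (wS n); ring.
  - move=> ?; exists (x, y) => _; split => //=; rewrite ?E2; lra.
  - rewrite (E2 x) => ?; exists (x + p * w n.+1, y) => _; split => //=; rewrite ?E2; lra.
  - rewrite (E2 y) => ?; exists (x, y + q * w n.+1) => _; split => //=; rewrite ?E2; lra.
  - rewrite (E2 x) (E2 y) => ?.
    by exists (x + p * w n.+1, y + q * w n.+1) => _; split => //=; rewrite ?E2; lra.
have [f Hf] := choice step.
pose z := nat_rect (fun=> (R * R)%type) (a, c) (fun n z => f (n, z)).
have Sz n : S n (z n).
  elim: n => [|n /(Hf (n, z n)) []//].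
  by rewrite /S /= /w expr0 expr1n !mulr1 /p /q !subrKC.
have {}Hf n := Hf (n, z n) (Sz n).
have mono1 n k : (z n).1 <= (z (n + k)%N).1 /\
    (z (n + k)%N).1 + p * w (n + k)%N <= (z n).1 + p * w n.
  elim: k => [|k [h1 h2]]; first by rewrite addn0.
  rewrite addnS; have [_ /= g1 g2 _ _] := Hf (n + k)%N.
  by split; [exact: le_trans g1|exact: le_trans h2].
have mono2 n k : (z n).2 <= (z (n + k)%N).2 /\
    (z (n + k)%N).2 + q * w (n + k)%N <= (z n).2 + q * w n.
  elim: k => [|k [h1 h2]]; first by rewrite addn0.
  rewrite addnS; have [_ /= _ _ g1 g2] := Hf (n + k)%N.
  by split; [exact: le_trans g1|exact: le_trans h2].
have [X HX] : exists X, forall n, (z n).1 <= X <= (z n).1 + p * w n.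
  apply: nested_point => m n.
  apply: le_trans (mono1 m n).1 _; rewrite addnC.
  apply: le_trans _ (mono1 n m).2; by rewrite lerDl mulr_ge0// ltW.
have [Y HY] : exists Y, forall n, (z n).2 <= Y <= (z n).2 + q * w n.
  apply: nested_point => m n.
  apply: le_trans (mono2 m n).1 _; rewrite addnC.
  apply: le_trans _ (mono2 n m).2; by rewrite lerDl mulr_ge0// ltW.
apply/ler_addgt0Pr => e e0; rewrite add0r.
(* Up to [w n ^+ 2], the Taylor bound multiplies the epsilon of differentiability by
   [4 * (p + q) ^+ 2]; the added 1 covers degenerate rectangles. *)
have pq1 : 0 < 4 * (p + q) ^+ 2 + 1 by rewrite ltr_wpDl// mulr_ge0 ?sqr_ge0.
have /hderP /(_ _ (divr_gt0 e0 pq1)) [r r0 Hr] := dH (cpt X Y).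
have r1 : 0 < r / (p + q + 1) by rewrite divr_gt0// ltr_wpDl// addr_ge0.
have [n wn] : exists n, w n < r / (p + q + 1).
  have half1 : `|2^-1 : R| < 1 by rewrite ger0_norm ?invr_ge0// invf_lt1// ltr1n.
  have /cvgrPdist_lt cw := cvg_expr half1; have [n _ /(_ n (leqnn n)) /=] := cw _ r1.
  by rewrite sub0r normrN ger0_norm ?(ltW (w0 n))//; exists n.
have pwn : 0 <= p * w n by rewrite mulr_ge0// ltW.
have qwn : 0 <= q * w n by rewrite mulr_ge0// ltW.
have := @bdry_le_taylor (cpt X Y) (e / (4 * (p + q) ^+ 2 + 1) * ((p + q) * w n))
   (z n).1 ((z n).1 + p * w n) (z n).2 ((z n).2 + q * w n).
rewrite !lerDl => /(_ pwn qwn) H1.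
have /(le_trans (Sz n)) : cn (bdry (z n).1 ((z n).1 + p * w n) (z n).2 ((z n).2 + q * w n)) <=
    4 * (e / (4 * (p + q) ^+ 2 + 1) * ((p + q) * w n)) * (p * w n + q * w n).
  apply: le_trans (H1 _) _; last by apply: eq_ler; ring.
  move=> x y hx hy.
  have dist : cn (cpt x y - cpt X Y) <= (p + q) * w n.
    apply: le_trans (cn_le_ReIm _) _ => /=; rewrite mulrDl.
    move: (HX n) (HY n) => HXn HYn.
    by apply: lerD; rewrite ler_norml; lra.
  have := Hr (cpt x y - cpt X Y); rewrite subrKC => {}Hr; rewrite opprD addrA.
  apply: le_trans (Hr _) _.
    apply: le_lt_trans dist _; move: wn; rewrite ltr_pdivlMr; last first.
      by rewrite ltr_wpDl// addr_ge0.
    by apply: le_lt_trans; rewrite mulrC ler_wpM2l ?lerDl// ltW.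
  by rewrite ler_wpM2l// ltW// divr_gt0.
have -> : 4 * (e / (4 * (p + q) ^+ 2 + 1) * ((p + q) * w n)) * (p * w n + q * w n)
  = e * (4 * (p + q) ^+ 2) / (4 * (p + q) ^+ 2 + 1) * w n ^+ 2.
  by field; rewrite gt_eqF.
rewrite ler_pM2r ?exprn_gt0// => /le_trans; apply.
by rewrite ler_pdivrMr// ler_wpM2l ?lerDl// ltW.
Qed.

End Goursat.

(** * Cauchy's estimate and entire functions *)

Section HolomorphicRules.
Variable R : realType.
Implicit Types (h k : Cc R -> Cc R) (z d e : Cc R).

Lemma hder_eq h z d e : is_derive z (1 : Cc R) h d -> d = e -> is_derive z (1 : Cc R) h e.
Proof. by move=> ? <-. Qed.

Lemma hder_affine (a b z : Cc R) :
  is_derive z (1 : Cc R) (fun t : Cc R => a + b * t) b.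
Proof.
apply/hderP => e e0; exists 1 => // t _.
have -> : a + b * (z + t) - (a + b * z) - b * t = 0 by ring.
by rewrite cn0 mulr_ge0 ?cn_ge0// ltW.
Qed.

Lemma hder_cstD (a : Cc R) h z d : is_derive z (1 : Cc R) h d ->
  is_derive z (1 : Cc R) (fun t : Cc R => a + h t) d.
Proof.
move=> /hderP H; apply/hderP => e /H [r r0 Hr]; exists r => // t /Hr.
by rewrite (_ : a + h (z + t) - (a + h z) = h (z + t) - h z)//; ring.
Qed.

Lemma hder_negarg h z d : is_derive (- z) (1 : Cc R) h d ->
  is_derive z (1 : Cc R) (fun t : Cc R => h (- t)) (- d).
Proof.
move=> /hderP H; apply/hderP => e /H [r r0 Hr]; exists r => // t tr.
have := Hr (- t); rewrite cnN => /(_ tr).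
by rewrite opprD mulrN mulNr.
Qed.

Lemma hderD h k z d e : is_derive z (1 : Cc R) h d -> is_derive z (1 : Cc R) k e ->
  is_derive z (1 : Cc R) (fun t : Cc R => h t + k t) (d + e).
Proof. by move=> ? ?; exact: is_deriveD. Qed.

Lemma hderB h k z d e : is_derive z (1 : Cc R) h d -> is_derive z (1 : Cc R) k e ->
  is_derive z (1 : Cc R) (fun t : Cc R => h t - k t) (d - e).
Proof. by move=> ? ?; exact: is_deriveB. Qed.

Lemma hderM h k z d e : is_derive z (1 : Cc R) h d -> is_derive z (1 : Cc R) k e ->
  is_derive z (1 : Cc R) (fun t : Cc R => h t * k t) (h z * e + k z * d).
Proof. by move=> ? ?; exact: is_deriveM. Qed.

Lemma hderZ (c : Cc R) h z d : is_derive z (1 : Cc R) h d ->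
  is_derive z (1 : Cc R) (fun t : Cc R => c * h t) (c * d).
Proof. by move=> ?; exact: is_deriveZ. Qed.

Lemma hderV h z d : h z != 0 -> is_derive z (1 : Cc R) h d ->
  is_derive z (1 : Cc R) (fun t : Cc R => (h t)^-1) (- (h z) ^- 2 * d).
Proof.
move=> hz [dh <-]; apply: DeriveDef; first exact: derivableV.
exact: deriveV.
Qed.

Lemma hder_shift h z (b d : Cc R) : is_derive (z + b) (1 : Cc R) h d ->
  is_derive z (1 : Cc R) (fun t : Cc R => h (t + b)) d.
Proof.
move=> /hderP H; apply/hderP => e /H [r r0 Hr]; exists r => // t /Hr.
by rewrite [z + t + b]addrAC.
Qed.

End HolomorphicRules.

(** * The complex exponential *)

Section ComplexExponential.
Variable R : realType.

Definition cexp (z : Cc R) : Cc R :=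
  Complex (expR (complex.Re z) * cos (complex.Im z))
    (expR (complex.Re z) * sin (complex.Im z)).

Lemma cexp0 : cexp 0 = 1.
Proof. by rewrite /cexp /= expR0 cos0 sin0 mulr1 mulr0. Qed.

Lemma cexpD (z w : Cc R) : cexp (z + w) = cexp z * cexp w.
Proof.
case: z w => a b [c d]; rewrite /cexp /= expRD cosD sinD.
by congr Complex; ring.
Qed.

Lemma cexpN (z : Cc R) : cexp z * cexp (- z) = 1.
Proof. by rewrite -cexpD subrr cexp0. Qed.

Lemma cn_cexp (z : Cc R) : cn (cexp z) = expR (complex.Re z).
Proof.
by rewrite /= !exprMn -mulrDr cos2Dsin2 mulr1 sqrtr_sqr ger0_norm ?expR_ge0.
Qed.

Lemma cexp_2pi (s t : R) : cexp (cpt s (t + pi *+ 2)) = cexp (cpt s t).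
Proof. by rewrite /cexp /= cosD2pi sinD2pi. Qed.

Lemma is_derive_cexp0 : is_derive (0 : Cc R) (1 : Cc R) cexp 1.
Proof.
apply/hderP => e0 e00.
(* The 9 is 4 + 5, from the bounds [b1] and [b2] on the real and the imaginary part; [e <= 1] serves
   to bound [expR x] by 3. *)
have [e [e_gt0 e1 ee0]] : exists e : R, [/\ 0 < e, e <= 1 & 9 * e <= e0].
  exists (Num.min (e0 / 9) 1); split; first by rewrite lt_min ltr01 divr_gt0.
    by rewrite ge_min lexx orbT.
  by rewrite -ler_pdivlMl// mulrC ge_min lexx.
have /is_derive_epsdelta /(_ e e_gt0) [r1 r10 H1] := is_derive_expR (0 : R).
have /is_derive_epsdelta /(_ e e_gt0) [r2 r20 H2] := is_derive_cos (0 : R).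
have /is_derive_epsdelta /(_ e e_gt0) [r3 r30 H3] := is_derive_sin (0 : R).
exists (Num.min e (Num.min r1 (Num.min r2 r3))).
  by rewrite lt_min e_gt0 lt_min r10 lt_min r20.
move=> t; rewrite !lt_min => /and4P[te t1 t2 t3].
rewrite add0r cexp0 mul1r; apply: le_trans (cn_le_ReIm _) _.
have := cn_Re t; have := cn_Im t.
case: t te t1 t2 t3 => x y; set T := cn _ => te t1 t2 t3 yT xT.
have {H1} := H1 x (le_lt_trans xT t1); have {H2} := H2 y (le_lt_trans yT t2).
have {H3} := H3 y (le_lt_trans yT t3).
rewrite !add0r expR0 cos0 sin0 oppr0 mul0r mul1r ?subr0 ?addr0 mul1r.
rewrite /cexp /=.
move: yT xT => /= yT xT.
set a := expR x; set c := cos y; set s := sin y.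
set r3' := s - y; set r2' := c - 1; set r1' := a - 1 - x => h3 h2 h1.
have -> : a * c - 1 - x = r1' + r2' * a by rewrite /r1' /r2'; ring.
have -> : a * s - 0 - y = (x + r1') * y + a * r3' by rewrite /r3' /r1'; ring.
have T0 : 0 <= T by exact: le_trans (normr_ge0 _) xT.
have xe : `|x| <= e by apply: le_trans xT (ltW te).
have h1' : `|r1'| <= e * T by apply: le_trans h1 _; rewrite ler_wpM2l// ltW.
have h1'' : `|r1'| <= `|x| by apply: le_trans h1 _; rewrite ler_piMl.
have h2' : `|r2'| <= e * T by apply: le_trans h2 _; rewrite ler_wpM2l// ltW.
have h3' : `|r3'| <= e * T by apply: le_trans h3 _; rewrite ler_wpM2l// ltW.
have a3 : `|a| <= 3.
  have -> : a = 1 + x + r1' by rewrite /r1'; ring.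
  apply: le_trans (ler_normD _ _) _; apply: le_trans (lerD (ler_normD _ _) h1'') _.
  by rewrite normr1; lra.
apply: (@le_trans _ _ (9 * (e * T))); last by rewrite mulrA ler_wpM2r.
have b1 : `|r1' + r2' * a| <= 4 * (e * T).
  apply: le_trans (ler_normD _ _) _; rewrite normrM.
  have : `|r2'| * `|a| <= e * T * 3 by rewrite ler_pM.
  lra.
have b2 : `|(x + r1') * y + a * r3'| <= 5 * (e * T).
  apply: le_trans (ler_normD _ _) _; rewrite !normrM.
  have : `|x + r1'| * `|y| <= (2 * e) * T.
    rewrite ler_pM//; apply: le_trans (ler_normD _ _) _; lra.
  have : `|a| * `|r3'| <= 3 * (e * T) by rewrite ler_pM.
  lra.
lra.
Qed.

(** By the addition theorem the increment at [z] is [cexp z] times the increment at 0. *)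
Lemma is_derive_cexp (z : Cc R) : is_derive z (1 : Cc R) cexp (cexp z).
Proof.
have /hderP H := is_derive_cexp0; apply/hderP => e e0.
have z0 : 0 < cn (cexp z) by rewrite cn_cexp expR_gt0.
have [r r0 Hr] := H _ (divr_gt0 e0 z0); exists r => // t /Hr.
rewrite add0r cexp0 cexpD => le.
have -> : cexp z * cexp t - cexp z - cexp z * t = cexp z * (cexp t - 1 - 1 * t) by ring.
by rewrite cnM mulrC -ler_pdivlMr// mulrAC.
Qed.

End ComplexExponential.

(** * Cauchy's estimate *)

Section CauchyEstimate.
Variable R : realType.

(* [H z = h (a + exp z) exp (- z)] has period [2 pi i], so by Goursat's lemma its
   integral [N s] over the vertical segment [[s, s + 2 pi i]] does not depend on
   [s]. For [s = ln r] it is bounded by [2 * (M / r) * 2 pi], and for [s -> -oo] it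
   tends to [2 pi h' a]. *)
Lemma cauchy_estimate (h h' : Cc R -> Cc R) (a : Cc R) (r M : R) : 0 < r ->
  (forall z, is_derive z (1 : Cc R) h (h' z)) ->
  (forall t, cn t = r -> cn (h (a + t)) <= M) -> cn (h' a) <= 2 * M / r.
Proof.
move=> r0 dh hM.
pose H (z : Cc R) : Cc R := h (a + cexp z) * cexp (- z).
have dcexpN z : is_derive z (1 : Cc R) (fun t : Cc R => cexp (- t)) (- cexp (- z)).
  exact/hder_negarg/is_derive_cexp.
have dcexp z : is_derive z (1 : Cc R) (fun t : Cc R => h (a + cexp t))
    (h' (a + cexp z) * cexp z).
  apply: (@hder_comp R (fun t : Cc R => a + cexp t) h) => //.
  exact/hder_cstD/is_derive_cexp.
pose H' (z : Cc R) : Cc R :=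
  h (a + cexp z) * - cexp (- z) + cexp (- z) * (h' (a + cexp z) * cexp z).
have dH z : is_derive z (1 : Cc R) H (H' z) by exact: hderM.
(* One choice of primitives for all curves: equal integrands then have equal primitives, so that the
   periodicity of [H] gives [U T = U 0]. *)
have /choice [P dP] (u : R -> Cc R) : exists U : R -> Cc R,
    (forall x, exists d, rder u x d) -> forall x, rder U x (u x).
  have [/ex_rprimitive [U dU]|nu] := pselect (forall x, exists d, rder u x d).
    by exists U.
  by exists (fun=> 0).
pose U y := P (fun x => H (cpt x y)); pose V x := P (fun y => H (cpt x y)).
have dU y x : rder (U y) x (H (cpt x y)).
  by apply: dP => {}x; exists (H' (cpt x y)); exact: rder_hor.
have dV x y : rder (V x) y (H (cpt x y)).
  by apply: dP => {}y; exists (H' (cpt x y) * 'i%C); exact: rder_ver.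
pose T : R := pi *+ 2.
have T0 : 0 < T by rewrite mulrn_wgt0// pi_gt0.
have cexpT s : cexp (cpt s T) = cexp (cpt s 0) by rewrite -(cexp_2pi s 0) add0r.
have cexpNT s : cexp (- cpt s T) = cexp (- cpt s 0).
  rewrite -[LHS]mul1r -(cexpN (cpt s 0)) -cexpT mulrAC cexpN mul1r.
  by [].
have UT : U T = U 0.
  congr P; apply/funext => x; rewrite /H cexpNT cexpT //.
pose N s := V s T - V s 0.
have N_le s1 s2 : s1 <= s2 -> N s1 = N s2.
  move=> s12; have := goursat dH dU dV s12 (ltW T0).
  rewrite /bdry UT => Z.
  have : 'i%C * (N s2 - N s1) = 0 :> Cc R by rewrite -Z /N; ring.
  move/eqP; rewrite mulf_eq0 => /orP[|]; last by rewrite subr_eq0 => /eqP.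
  by rewrite -cn_eq0 cn_i oner_eq0.
have N_cst s1 s2 : N s1 = N s2.
  by have [/N_le//|/ltW /N_le] := leP s1 s2.
have cnCexpN x y : cn (cexp (- cpt x y)) = (expR x)^-1 by rewrite cn_cexp /= expRN.
have N_bound : cn (N (ln r)) <= 2 * (M / r) * T.
  rewrite -[T in leRHS]subr0.
  apply: (@rder_mvt R _ (fun y => H (cpt (ln r) y))); [exact: ltW|by []|].
  move=> y _; rewrite /H cnM cnCexpN lnK// ler_wpM2r ?invr_ge0 ?(ltW r0)//.
  by apply: hM; rewrite cn_cexp lnK.
have N_lim : N (ln r) = h' a * T%:C%C.
  apply/eqP; rewrite -subr_eq0 -cn_eq0 eq_le cn_ge0 andbT.
  apply/ler_addgt0Pr => e e0; rewrite add0r.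
  have e1 : 0 < e / (2 * T) by rewrite divr_gt0// mulr_gt0.
  have /hderP /(_ _ e1) [d d0 Hd] := dh a.
  pose s := ln (d / 2); have es : expR s = d / 2 by rewrite lnK// posrE divr_gt0.
  rewrite (N_cst _ s).
  (* Along vertical lines [G] is a primitive of [(h a + h' a * cexp z) * cexp (- z)], the
     first-order part of [H]. The exponential term of [G] is periodic, so its increment over a
     period is [h' a * T]. *)
  pose G (z : Cc R) : Cc R := h a * 'i%C * cexp (- z) + h' a * - 'i%C * z.
  have i2 : 'i%C * 'i%C = -1 :> Cc R by exact: sqr_i.
  have dG z : is_derive z (1 : Cc R) G (h a * 'i%C * - cexp (- z) + h' a * - 'i%C).
    have lin : is_derive z (1 : Cc R) (fun t : Cc R => h' a * - 'i%C * t) (h' a * - 'i%C).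
      have := hder_affine 0 (h' a * - 'i%C) z.
      by under [X in is_derive _ _ X _]eq_fun do rewrite add0r.
    exact: hderD (hderZ (h a * 'i%C) (dcexpN z)) lin.
  have -> : N s - h' a * T%:C%C = (V s T - G (cpt s T)) - (V s 0 - G (cpt s 0)).
    rewrite /N /G cexpNT !cptE /=.
    rewrite (_ : (0 : R)%:C%C = 0 :> Cc R)//.
    have : 'i%C * 'i%C * (h' a * T%:C%C) = - (h' a * T%:C%C) by rewrite i2 mulN1r.
    move: (T%:C%C : Cc R) (s%:C%C : Cc R) => t s' E.
    by apply/eqP; rewrite -subr_eq0; apply/eqP; rewrite -[h' a * t]opprK -E; ring.
  have -> : e = 2 * (e / (2 * T)) * (T - 0).
    by move: (T) T0 => t t0; rewrite subr0; field; rewrite gt_eqF.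
  apply: (@rder_mvt R (fun y => V s y - G (cpt s y)) (fun y => H (cpt s y)
    - (h a * 'i%C * - cexp (- cpt s y) + h' a * - 'i%C) * 'i%C)); first exact: ltW.
    by move=> y _; apply: rderB; [exact: dV|exact: rder_ver].
  move=> y _; set z := cpt s y.
  have -> : H z - (h a * 'i%C * - cexp (- z) + h' a * - 'i%C) * 'i%C =
      (h (a + cexp z) - h a - h' a * cexp z) * cexp (- z).
    have -> : (h a * 'i%C * - cexp (- z) + h' a * - 'i%C) * 'i%C =
      ('i%C * 'i%C) * (- h a * cexp (- z) - h' a) by ring.
    transitivity (h (a + cexp z) * cexp (- z) - h a * cexp (- z)
      - h' a * (cexp z * cexp (- z))); last by ring.
    by rewrite i2 cexpN /H; ring.
  rewrite cnM cnCexpN ler_pdivrMr ?expR_gt0//.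
  have := Hd (cexp z); rewrite cn_cexp /= => Hd'; apply: Hd'.
  by rewrite es ltr_pdivrMr// ltr_pMr// ltr1n.
move: N_bound; rewrite N_lim cnM cn_real gtr0_norm//.
by rewrite ler_pM2r// mulrA.
Qed.

End CauchyEstimate.

(** * Entire functions: Taylor bounds, second derivatives, Liouville *)

Section EntireFunctions.
Variable R : realType.
Implicit Types (h dh : Cc R -> Cc R) (a s t z : Cc R) (M : R).

Definition entire h dh := forall z, is_derive z (1 : Cc R) h (dh z).

Lemma cn_segment z (x : R) : 0 <= x <= 1 -> cn (x%:C%C * z) <= cn z.
Proof.
by move=> /andP[x0 x1]; rewrite cnM cn_real ger0_norm// ler_piMl// cn_ge0.
Qed.

Lemma entire_mvt h dh a s (K : R) : entire h dh ->
  (forall x : R, 0 <= x <= 1 -> cn (dh (a + x%:C%C * s)) <= K) ->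
  cn (h (a + s) - h a) <= 2 * K * cn s.
Proof.
move=> hh hK.
have := @rder_mvt R (fun x => h (a + x%:C%C * s)) (fun x => dh (a + x%:C%C * s) * s)
  0 1 (K * cn s) ler01.
have -> : (0 : R)%:C%C = 0 :> Cc R by [].
have -> : (1 : R)%:C%C = 1 :> Cc R by [].
rewrite mul0r mul1r addr0 subr0 mulr1 mulrA; apply.
  by move=> x _; exact: rder_slice.
by move=> x /hK; rewrite cnM => le; rewrite ler_wpM2r ?cn_ge0.
Qed.

Lemma entire_shift h dh s : entire h dh ->
  entire (fun z => h (z + s)) (fun z => dh (z + s)).
Proof. by move=> hh z; exact: hder_shift. Qed.

Lemma entire_scale h dh (c : Cc R) : entire h dh ->
  entire (fun z => h (c * z)) (fun z => c * dh (c * z)).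
Proof.
move=> hh z; apply/hderP => e e0.
have c1 : 0 < cn c + 1 by rewrite ltr_wpDl ?cn_ge0.
have /hderP /(_ _ (divr_gt0 e0 c1)) [r r0 Hr] := hh (c * z).
exists (r / (cn c + 1)) => [|t tr]; first exact: divr_gt0.
have ct : cn (c * t) <= (cn c + 1) * cn t by rewrite cnM ler_wpM2r ?cn_ge0// lerDl.
rewrite mulrDr (_ : c * dh (c * z) * t = dh (c * z) * (c * t)); last by ring.
apply: le_trans (Hr _ _) _.
  by apply: le_lt_trans ct _; rewrite mulrC -ltr_pdivlMr.
apply: le_trans (ler_wpM2l _ ct) _; first by rewrite divr_ge0// ltW.
by rewrite mulrA divfK// gt_eqF.
Qed.

Lemma entireB h dh k dk : entire h dh -> entire k dk ->
  entire (fun z => h z - k z) (fun z => dh z - dk z).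
Proof. by move=> hh hk z; exact: hderB. Qed.

Lemma entireZ (c : Cc R) h dh : entire h dh ->
  entire (fun z => c * h z) (fun z => c * dh z).
Proof. by move=> hh z; exact: hderZ. Qed.

(** Cauchy's estimate for the difference of [h] and a translate shows that [dh] is Lipschitz, which
    replaces a bound on the second derivative. The radius 3 is one unit for the translation and one
    for each circle of integration; each of the four estimates doubles the constant, from [M] to
    [16 * M]. *)
Lemma entire_taylor h dh a M s : entire h dh ->
  (forall t, cn t <= 3 -> cn (h (a + t)) <= M) -> cn s <= 1 ->
  cn (h (a + s) - h a - dh a * s) <= 16 * M * cn s ^+ 2.
Proof.
move=> hh hM s1.
have M0 : 0 <= M by apply: le_trans (hM 0 _); rewrite ?cn0 ?cn_ge0.
have bound_dh t : cn t <= 2 -> cn (dh (a + t)) <= 2 * M.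
  move=> t2; rewrite -[2 * M]divr1; apply: (cauchy_estimate ltr01 hh) => u u1.
  by rewrite -addrA; apply: hM; apply: le_trans (cnD _ _) _; lra.
have bound_diff t z : cn t <= 1 -> cn z <= 1 ->
    cn (h (a + t + z) - h (a + t)) <= 4 * M * cn z.
  move=> t1 z1; have -> : 4 * M = 2 * (2 * M) by ring.
  apply: (entire_mvt hh) => x /(@cn_segment z) xs; rewrite -addrA; apply: bound_dh.
  by apply: le_trans (cnD _ _) _; lra.
have lip_dh z : cn z <= 1 -> cn (dh (a + z) - dh a) <= 8 * M * cn z.
  move=> z1; have -> : 8 * M * cn z = 2 * (4 * M * cn z) / 1 by rewrite divr1; ring.
  apply: (cauchy_estimate ltr01 (entireB (entire_shift z hh) hh)) => u u1.
  by apply: bound_diff; rewrite ?u1.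
have hk z : is_derive z (1 : Cc R) (fun t : Cc R => h t - (0 + dh a * t)) (dh z - dh a).
  exact/hderB/hder_affine.
have := entire_mvt (a := a) (s := s) (K := 8 * M * cn s) hk.
have -> : h (a + s) - (0 + dh a * (a + s)) - (h a - (0 + dh a * a))
  = h (a + s) - h a - dh a * s by ring.
have -> : 2 * (8 * M * cn s) * cn s = 16 * M * cn s ^+ 2 by ring.
apply=> x /(@cn_segment s) xs.
apply: le_trans (lip_dh _ (le_trans xs s1)) _.
by rewrite ler_wpM2l// mulr_ge0.
Qed.

Section DerivativeWithParameter.
Variables (K Ks Kt : Cc R -> Cc R -> Cc R).
Hypothesis hKs : forall t, entire (K^~ t) (Ks^~ t).
Hypothesis hKt : forall s, entire (K s) (Kt s).

(* The difference quotients [D w] of [K] in [t] are entire in [s] and converge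
   locally uniformly to [Kt^~ 0]; by Cauchy's estimate so do their
   derivatives. *)
Lemma param_derive_taylor M :
  (forall s t, cn s <= 4 -> cn t <= 4 -> cn (K s t) <= M) ->
  exists E, forall s, cn s <= 1 ->
    cn (Kt s 0 - Kt 0 0 - E * s) <= 288 * M * cn s ^+ 2.
Proof.
move=> KM.
have M0 : 0 <= M by apply: le_trans (KM 0 0 _ _); rewrite ?cn0 ?cn_ge0.
pose D (w s : Cc R) : Cc R := w^-1 * (K s w - K s 0).
pose dD (w s : Cc R) : Cc R := w^-1 * (Ks s w - Ks s 0).
have hD w : entire (D w) (dD w) by apply/entireZ/entireB.
have DKt w s : w != 0 -> cn w <= 1 -> cn s <= 4 -> cn (D w s - Kt s 0) <= 16 * M * cn w.
  move=> w0 w1 s4.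
  have := @entire_taylor (K s) (Kt s) 0 M w (hKt s).
  rewrite !add0r => /(_ _ w1) T.
  rewrite (_ : D w s - Kt s 0 = w^-1 * (K s w - K s 0 - Kt s 0 * w)); last first.
    by rewrite /D; field.
  rewrite cnM cnV ler_pdivrMl ?cn_gt0//; apply: le_trans (T _) _.
    by move=> t t3; rewrite add0r KM//; lra.
  by apply: eq_ler; ring.
have KtM s : cn s <= 4 -> cn (Kt s 0) <= 2 * M.
  move=> s4; rewrite -[2 * M]divr1; apply: (cauchy_estimate ltr01 (hKt s)) => u u1.
  by rewrite add0r KM// u1; lra.
(* The 18 is 16 from [DKt] plus 2 from [KtM]; the Taylor bound for [D] then produces 288 as 16 *
   18. *)
have DM w s : w != 0 -> cn w <= 1 -> cn s <= 4 -> cn (D w s) <= 18 * M.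
  move=> w0 w1 s4; rewrite -[D w s](subrK (Kt s 0)); apply: le_trans (cnD _ _) _.
  have := DKt w s w0 w1 s4; have := KtM s s4; have : M * cn w <= M by rewrite ler_piMr.
  lra.
have dDB w v : w != 0 -> v != 0 -> cn w <= 1 -> cn v <= 1 ->
    cn (dD w 0 - dD v 0) <= 32 * M * (cn w + cn v).
  move=> w0 v0 w1 v1.
  have -> : 32 * M * (cn w + cn v) = 2 * (16 * M * (cn w + cn v)) / 1.
    by rewrite divr1; ring.
  apply: (cauchy_estimate ltr01 (entireB (hD w) (hD v))) => u u1; rewrite add0r.
  have u4 : cn u <= 4 by rewrite u1; lra.
  rewrite (_ : D w u - D v u = (D w u - Kt u 0) - (D v u - Kt u 0)); last by ring.
  apply: le_trans (cnB _ _) _; rewrite mulrDr.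
  by apply: lerD; exact: DKt.
pose w n : Cc R := (n.+1%:R^-1 : R)%:C%C.
have cw n : cn (w n) = n.+1%:R^-1 by rewrite cn_real ger0_norm.
have w1 n : cn (w n) <= 1 by rewrite cw invf_le1// ler1n.
have w0 n : w n != 0 by rewrite -cn_gt0 cw invr_gt0.
pose e n := dD (w n) 0.
(* [p] stands for the real or the imaginary part. By [dDB] the intervals of radius
   [32 * M * cn (w n)] around [p (e n)] meet pairwise. *)
have lim (p : Cc R -> R) : (forall z1 z2, `|p z1 - p z2| <= cn (z1 - z2)) ->
    exists X, forall n, `|p (e n) - X| <= 32 * M * cn (w n).
  move=> pcn; have [] := @nested_point R (fun n => p (e n) - 32 * M * cn (w n))
    (fun n => p (e n) + 32 * M * cn (w n)).
    move=> m n; have := dDB (w m) (w n) (w0 m) (w0 n) (w1 m) (w1 n).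
    move=> /(le_trans (pcn _ _)); rewrite -/(e m) -/(e n) => /ler_normlP [_].
    lra.
  by move=> X HX; exists X => n; have := HX n; rewrite ler_norml; lra.
have [|X HX] := lim (@complex.Re R).
  by move=> z1 z2; rewrite -cReN -cReD cn_Re.
have [|Y HY] := lim (@complex.Im R).
  by move=> z1 z2; rewrite -cImN -cImD cn_Im.
exists (Complex X Y) => s s1.
have eE n : cn (e n - (Complex X Y : Cc R)) <= 64 * M * cn (w n).
  apply: le_trans (cn_le_ReIm _) _; rewrite cReD cImD cReN cImN.
  rewrite (_ : 64 * M * _ = 32 * M * cn (w n) + 32 * M * cn (w n)); last by ring.
  exact: lerD (HX n) (HY n).
apply/ler_addgt0Pr => x x0.
(* The 96 is 16 + 16 + 64, for the errors [T1], [T2] and [T4] of replacing [Kt] by [D] and the limit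
   by [e n]. *)
have [n xn] : exists n, 96 * M * cn (w n) <= x.
  exists (Num.truncn (96 * M / x)); rewrite cw ler_pdivrMr//.
  rewrite -ler_pdivrMl// mulrC; exact/ltW/truncnS_gt.
have s4 : cn s <= 4 by lra.
have z4 : cn (0 : Cc R) <= 4 by rewrite cn0.
have T1 := DKt _ s (w0 n) (w1 n) s4.
have T2 := DKt _ 0 (w0 n) (w1 n) z4.
have T3 : cn (D (w n) s - D (w n) 0 - e n * s) <= 288 * M * cn s ^+ 2.
  have := @entire_taylor _ _ 0 (18 * M) s (hD (w n)); rewrite add0r => T.
  apply: le_trans (T _ s1) _ => [t t3|]; first by rewrite add0r DM//; lra.
  by apply: eq_ler; ring.
have T4 : cn ((e n - (Complex X Y : Cc R)) * s) <= 64 * M * cn (w n).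
  by rewrite cnM; apply: le_trans (eE n); rewrite ler_piMr ?cn_ge0.
rewrite (_ : Kt s 0 - Kt 0 0 - Complex X Y * s =
  (D (w n) s - D (w n) 0 - e n * s) - (D (w n) s - Kt s 0) + (D (w n) 0 - Kt 0 0)
    + (e n - (Complex X Y : Cc R)) * s); last by ring.
apply: le_trans (cnD _ _) _.
apply: le_trans (lerD (cnD _ _) (lexx _)) _.
apply: le_trans (lerD (lerD (cnB _ _) (lexx _)) (lexx _)) _.
lra.
Qed.

End DerivativeWithParameter.

Lemma taylor_is_derive h (E : Cc R) (M : R) :
  (forall s, cn s <= 1 -> cn (h s - h 0 - E * s) <= M * cn s ^+ 2) ->
  is_derive (0 : Cc R) (1 : Cc R) h E.
Proof.
move=> hM; apply/hderP => e e0.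
have M1 : 0 < `|M| + 1 by rewrite ltr_wpDl.
exists (Num.min 1 (e / (`|M| + 1))); first by rewrite lt_min ltr01 divr_gt0.
move=> s; rewrite lt_min add0r => /andP[/ltW s1 se].
apply: le_trans (hM s s1) _; rewrite expr2 mulrA ler_wpM2r ?cn_ge0//.
apply: (@le_trans _ _ ((`|M| + 1) * cn s)).
  by rewrite ler_wpM2r ?cn_ge0//; have := ler_norm M; lra.
by rewrite mulrC -ler_pdivlMr// ltW.
Qed.

(** Scaling both variables by [r / 4] reduces to the radius 4 above. All second derivatives come
    from this lemma, in one variable ([entire_derive]) and in several ([Dmx_derivable]). *)
Lemma param_is_derive (K Ks Kt : Cc R -> Cc R -> Cc R) (r M : R) : 0 < r ->
  (forall t, entire (K^~ t) (Ks^~ t)) -> (forall s, entire (K s) (Kt s)) ->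
  (forall s t, cn s <= r -> cn t <= r -> cn (K s t) <= M) ->
  exists E, is_derive (0 : Cc R) (1 : Cc R) (Kt^~ 0) E.
Proof.
move=> r0 hKs hKt KM; pose c : Cc R := (r / 4)%:C%C.
have cr : cn c = r / 4 by rewrite cn_real ger0_norm// divr_ge0// ltW.
have c0 : c != 0 by rewrite -cn_gt0 cr divr_gt0.
have cM z : cn z <= 4 -> cn (c * z) <= r.
  move=> z4; rewrite cnM cr; apply: le_trans (ler_wpM2l _ z4) _.
    by rewrite divr_ge0// ltW.
  by rewrite divfK.
clearbody c.
have [|E HE] := @param_derive_taylor (fun s t => K (c * s) (c * t))
  (fun s t => c * Ks (c * s) (c * t)) (fun s t => c * Kt (c * s) (c * t))
  (fun t => entire_scale c (hKs (c * t))) (fun s => entire_scale c (hKt (c * s))) M.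
  by move=> s t /cM cs /cM ct; exact: KM.
have dE := @taylor_is_derive (fun s => c * Kt (c * s) (c * 0)) E _ HE.
exists (c^-1 * (c^-1 * E)); apply/hderP => e e0.
have ec : 0 < e * cn c ^+ 2 by rewrite mulr_gt0// exprn_gt0// cn_gt0.
have /hderP /(_ _ ec) [d d0 Hd] := dE.
exists (cn c * d); first by rewrite mulr_gt0 ?cn_gt0.
move=> t td; have := Hd (c^-1 * t); rewrite cnM cnV ltr_pdivrMl ?cn_gt0// => /(_ td).
rewrite !add0r !mulr0 mulVKf//.
rewrite (_ : c * Kt t 0 - c * Kt 0 0 - E * (c^-1 * t) =
  c * (Kt t 0 - Kt 0 0 - c^-1 * (c^-1 * E) * t)); last by field.
have cc : 0 < cn c by rewrite cn_gt0.
rewrite cnM => le; rewrite -(ler_pM2l cc); apply: le_trans le _.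
by apply: eq_ler; field; rewrite gt_eqF.
Qed.

Lemma hder_bounded h z d : is_derive z (1 : Cc R) h d ->
  exists2 r : R, 0 < r & forall t, cn t <= r -> cn (h (z + t) - h z) <= 1.
Proof.
move=> /hderP /(_ 1 ltr01) [r r0 Hr].
have d1 : 0 < cn d + 1 by rewrite ltr_wpDl ?cn_ge0.
exists (Num.min (r / 2) (cn d + 1)^-1); first by rewrite lt_min divr_gt0// invr_gt0.
move=> t; rewrite le_min => /andP[tr td].
rewrite -[h (z + t) - h z](subrK (d * t)); apply: le_trans (cnD _ _) _.
have tr' : cn t < r by lra.
apply: le_trans (lerD (Hr _ tr') (lexx _)) _; rewrite mul1r cnM.
move: td; rewrite -[_^-1]mulr1 ler_pdivlMl//; lra.
Qed.

(** For [K s t = h (z + s + t)] the [t]-derivative at [t = 0] is [dh (z + s)], so its [s]-derivative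
    at 0 is the second derivative at [z]. *)
Lemma entire_derive h dh : entire h dh -> exists ddh, entire dh ddh.
Proof.
move=> hh; suff /choice[ddh H] z : exists E, is_derive z (1 : Cc R) dh E by exists ddh.
have [r r0 Hr] := hder_bounded (hh z).
have hK s : entire (fun t => h (z + s + t)) (fun t => dh (z + s + t)).
  move=> t; have := entire_shift (z + s) hh t.
  rewrite [t + _]addrC; congr is_derive.
  by apply/funext => u; rewrite addrC.
have [||E] := @param_is_derive (fun s t => h (z + s + t)) (fun s t => dh (z + s + t))
  (fun s t => dh (z + s + t)) (r / 2) (cn (h z) + 1) (divr_gt0 r0 (ltr0Sn _ _)) _ hK.
- move=> t s; have := hK t s; rewrite (addrAC z); congr is_derive.
  by apply/funext => u; rewrite addrAC.
- move=> s t sr tr; rewrite -[X in cn X](subrK (h z)) addrC.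
  apply: le_trans (cnD _ _) _; rewrite lerD// -addrA Hr//.
  by apply: le_trans (cnD _ _) _; lra.
move=> /hderP H; exists E; apply/hderP => e /H [d d0 Hd]; exists d => // t /Hd.
by rewrite !addr0 add0r.
Qed.

(** Liouville's argument for [dh]: Cauchy's estimate on arbitrarily large circles forces
    [ddh = 0]. *)
Lemma entire_derive_bounded h dh (B : R) : entire h dh -> (forall z, cn (dh z) <= B) ->
  forall z, h z = h 0 + dh 0 * z.
Proof.
move=> hh hB; have [ddh hdh] := entire_derive hh.
have B0 : 0 <= B by apply: le_trans (hB 0); exact: cn_ge0.
have ddh0 z : cn (ddh z) <= 0.
  apply/ler_addgt0Pr => e e0; rewrite add0r.
  have B1 : 0 < 2 * B + 1 by lra.
  apply: le_trans (cauchy_estimate (divr_gt0 B1 e0) hdh _) _ => [t _|]; first exact: hB.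
  by rewrite invf_div mulrA ler_pdivrMr//; rewrite mulrC ler_wpM2l ?ltW//; lra.
have cn_le0 z : cn z <= 0 -> z = 0.
  by move=> z0; apply/eqP; rewrite -cn_eq0 eq_le z0 cn_ge0.
have dh0 z : dh z = dh 0.
  apply/eqP; rewrite -subr_eq0; apply/eqP/cn_le0.
  have := @entire_mvt dh ddh 0 z 0 hdh; rewrite add0r mulr0 mul0r; apply.
  by move=> x _; exact: ddh0.
move=> z; apply/eqP; rewrite -subr_eq0 opprD addrA; apply/eqP/cn_le0.
have hk t : is_derive t (1 : Cc R) (fun t : Cc R => h t - (0 + dh 0 * t)) (dh t - dh 0).
  exact/hderB/hder_affine.
have := @entire_mvt _ _ 0 z 0 hk; rewrite (_ : 2 * 0 * cn z = 0); last by ring.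
have -> : h (0 + z) - (0 + dh 0 * (0 + z)) - (h 0 - (0 + dh 0 * 0)) = h z - h 0 - dh 0 * z.
  by rewrite add0r; ring.
by apply=> x _; rewrite dh0 subrr cn0.
Qed.

Lemma entire_linear_growth h dh (r c : R) : entire h dh ->
  (forall z, r <= cn z -> cn (h z) <= c * cn z) -> forall z, h z = h 0 + dh 0 * z.
Proof.
move=> hh hc; apply: (@entire_derive_bounded h dh (4 * `|c|)) => // a.
(* The circle of this radius around [a] avoids the open disc of radius [r] around 0 and stays within
   [2 * s] of 0. *)
pose s := cn a + `|r| + 1; have s0 : 0 < s by rewrite /s ltr_wpDl// addr_ge0 ?cn_ge0.
have -> : 4 * `|c| = 2 * (2 * `|c| * s) / s by field; rewrite gt_eqF.
apply: (cauchy_estimate s0 hh) => t ts.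
have at_r : r <= cn (a + t).
  have := cnB (a + t) a; rewrite addrAC subrr add0r ts /s.
  by have := ler_norm r; lra.
apply: le_trans (hc _ at_r) _; have := ler_norm c => lec.
apply: le_trans (ler_wpM2r (cn_ge0 _) lec) _.
rewrite -mulrA mulrCA ler_wpM2l//; apply: le_trans (cnD _ _) _; rewrite ts.
by rewrite /s; have := normr_ge0 r; lra.
Qed.

End EntireFunctions.

(** * Normalised automorphisms of the line, and collinear curves *)

Section OneVariable.
Variable R : realType.

Lemma hder_near (h k : Cc R -> Cc R) (z d : Cc R) (r : R) : 0 < r ->
  (forall t, cn t < r -> h (z + t) = k (z + t)) ->
  is_derive z (1 : Cc R) h d -> is_derive z (1 : Cc R) k d.
Proof.
move=> r0 hk /hderP H; apply/hderP => e /H [s s0 Hs].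
exists (Num.min r s) => [|t]; first by rewrite lt_min r0.
rewrite lt_min => /andP[tr /Hs]; rewrite hk// -[z in h z]addr0 hk ?addr0//.
by rewrite cn0.
Qed.

(** Removable singularity at 0. The derivative there is half of [ddh 0]: subtracting from [h] its
    quadratic Taylor polynomial leaves a function whose derivative is the first-order remainder of
    [dh], to which the mean value estimate applies. *)
Lemma entire_quotient (h dh : Cc R -> Cc R) : entire h dh -> h 0 = 0 ->
  exists dk, entire (fun t : Cc R => if t == 0 then dh 0 else h t / t) dk.
Proof.
move=> hh h0; have [ddh hdh] := entire_derive hh.
set k := fun t : Cc R => _.
suff /choice[dk H] z : exists E, is_derive z (1 : Cc R) k E by exists dk.
have [->|z0] := eqVneq z 0; last first.
  have dq := hderM (hh z) (hderV z0 (is_derive_id z 1)).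
  eexists; apply: (hder_near (r := cn z) _ _ dq) => [|t tz]; first by rewrite cn_gt0.
  rewrite /k; case: eqP => // /eqP; rewrite addr_eq0 => /eqP zt.
  by move: tz; rewrite zt cnN ltxx.
exists (ddh 0 / 2%:R); apply/hderP => e e0.
have /hderP /(_ _ (divr_gt0 e0 (ltr0Sn _ 1))) [r r0 Hr] := hdh 0.
exists r => // t tr; rewrite add0r.
have [->|t0] := eqVneq t 0; first by rewrite subrr mulr0 subr0 cn0 mulr0.
rewrite /k (negPf t0) eqxx.
rewrite (_ : h t / t - dh 0 - ddh 0 / 2%:R * t =
  t^-1 * (h t - (dh 0 * (t - 0) + ddh 0 / 2%:R * (t - 0) ^+ 2))); last first.
  by field.
rewrite cnM cnV ler_pdivrMl ?cn_gt0//.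
have hG v : is_derive v (1 : Cc R)
    (fun z : Cc R => h z - (dh 0 * (z - 0) + ddh 0 / 2%:R * (z - 0) ^+ 2))
    (dh v - (dh 0 + ddh 0 * (v - 0))).
  exact/hderB/quad_is_derive.
have := @entire_mvt R _ _ 0 t (e / 2 * cn t) hG.
rewrite (_ : h (0 + t) - _ - _ =
  h t - (dh 0 * (t - 0) + ddh 0 / 2%:R * (t - 0) ^+ 2)); last first.
  by rewrite add0r h0; ring.
have -> : 2 * (e / 2 * cn t) * cn t = cn t * (e * cn t) by field.
apply=> x x01; have xt := @cn_segment R t x x01.
rewrite add0r opprD addrA; have := Hr (x%:C%C * t) (le_lt_trans xt tr).
rewrite add0r subr0 => /le_trans; apply.
by rewrite ler_wpM2l// divr_ge0// ltW.
Qed.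

Lemma entire_automorphism (h dh k dk : Cc R -> Cc R) : entire h dh -> entire k dk ->
  cancel h k -> h 0 = 0 -> dh 0 = 1 -> forall t, h t = t.
Proof.
move=> hh hk hK h0 dh0.
have k0 : k 0 = 0 by rewrite -[X in k X]h0 hK.
have h_neq0 t : t != 0 -> h t != 0.
  by apply: contra_neq => ht; rewrite -(hK t) ht.
have [dpsi hpsi] := entire_quotient hh h0.
set psi := fun t : Cc R => _ in hpsi.
have psi_neq0 t : psi t != 0.
  rewrite /psi; have [_|t0] := eqVneq t 0; first by rewrite dh0 oner_neq0.
  by rewrite mulf_neq0 ?invr_eq0// h_neq0.
have hp t : is_derive t (1 : Cc R) (fun z => (psi z)^-1) (- (psi t) ^- 2 * dpsi t).
  exact: hderV.
have [r r0 Hr] := hder_bounded (hk 0).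
(* If [h z] were within [r] of 0, then [z = k (h z)] would have modulus at most 1. *)
have growth z : 2 <= cn z -> cn (psi z)^-1 <= r^-1 * cn z.
  move=> z2; have z0 : z != 0 by rewrite -cn_gt0; lra.
  rewrite /psi (negPf z0) invf_div cnM cnV mulrC ler_wpM2r ?cn_ge0//.
  rewrite lef_pV2 ?posrE ?cn_gt0 ?h_neq0//; apply: ltW; rewrite ltNge; apply/negP.
  by move=> /Hr; rewrite add0r hK k0 subr0; lra.
have affine := entire_linear_growth hp growth.
have psi0 : psi 0 = 1 by rewrite /psi eqxx.
(* A slope [b <> 0] would give the affine function a zero at [- b^-1], but the reciprocal of [psi]
   has none. *)
have b0 : - (psi 0) ^- 2 * dpsi 0 = 0.
  apply/eqP; apply/negP => /negP b0; set b := _ * _ in b0 affine.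
  have := affine (- b^-1); rewrite mulrN divff// psi0 invr1 subrr => /eqP.
  by rewrite invr_eq0 (negPf (psi_neq0 _)).
move=> t; have [->//|t0] := eqVneq t 0.
have := affine t; rewrite b0 mul0r addr0 psi0 invr1 /psi (negPf t0).
move=> /(congr1 (fun x => x^-1)); rewrite invrK invr1 => /(congr1 (fun x => x * t)).
by rewrite divfK// mul1r.
Qed.

Lemma is_derive_div (f g : R -> R) (x a b : R) : g x != 0 ->
  is_derive x (1 : R) f a -> is_derive x (1 : R) g b ->
  is_derive x (1 : R) (fun t => f t / g t) ((a * g x - f x * b) / g x ^+ 2).
Proof.
move=> gx df [dg bE].
have dV : is_derive x (1 : R) (fun t => (g t)^-1) (- (g x) ^- 2 * b).
  by apply: DeriveDef; [exact: derivableV|rewrite deriveV// bE].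
have [dm dE] := is_deriveM df dV; apply: DeriveDef => //.
by rewrite dE -![_ *: _]/(_ * _); field.
Qed.

Lemma is_derive_sqrn (U : R -> Cc R) (x : R) (d : Cc R) : rder U x d ->
  is_derive x (1 : R) (fun t => cn (U t) ^+ 2)
    (2 * (complex.Re (U x) * complex.Re d + complex.Im (U x) * complex.Im d)).
Proof.
move=> [dr di].
have [dm dE] := is_deriveD (is_deriveM dr dr) (is_deriveM di di).
rewrite (_ : (fun t => _) = (fun t => complex.Re (U t)) * (fun t => complex.Re (U t))
  + (fun t => complex.Im (U t)) * (fun t => complex.Im (U t))).
  by apply: DeriveDef => //; rewrite dE -![_ *: _]/(_ * _); ring.
by apply/funext => t; rewrite cn_sqr !fctE !expr2.
Qed.

Lemma is_derive_sum_fun n (h : 'I_n -> R -> R) (x : R) (d : 'I_n -> R) :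
  (forall i, is_derive x (1 : R) (h i) (d i)) ->
  is_derive x (1 : R) (fun t => \sum_i h i t) (\sum_i d i).
Proof.
move=> hd; rewrite (_ : (fun t => _) = \sum_i h i); first exact: is_derive_sum.
by apply/funext => t; rewrite fct_sumE.
Qed.

(* [|c_j w_i - c_i w_j|^2 / |c|^2] is constant along each ray and tends to 0 at
   the origin. *)
Lemma collinear_of_derive n (c dc : 'I_n -> Cc R -> Cc R) (w : 'I_n -> Cc R) (i : 'I_n) :
  (forall j, entire (c j) (dc j)) -> (forall j, c j 0 = 0) -> (forall j, dc j 0 = w j) ->
  (forall t, t != 0 -> exists l, forall j, dc j t = l * c j t) ->
  (forall t, t != 0 -> exists j, c j t != 0) -> w i != 0 ->
  forall t j, c j t * w i = c i t * w j.
Proof.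
move=> hc c0 dc0 dcl cn0' wi t j.
have [->|t0] := eqVneq t 0; first by rewrite !c0 !mul0r.
pose y (x : R) : Cc R := w i * c j (0 + x%:C%C * t) - w j * c i (0 + x%:C%C * t).
pose N (x : R) : R := \sum_k cn (c k (0 + x%:C%C * t)) ^+ 2.
have xt0 (x : R) : 0 < x -> x%:C%C * t != 0.
  by move=> x0; rewrite mulf_neq0// -cn_gt0 cn_real normr_gt0 gt_eqF.
have N0 x : 0 < x -> 0 < N x.
  move=> /xt0 /cn0' [k ck]; rewrite /N (bigD1 k)//= ltr_pwDl//.
    by rewrite add0r exprn_gt0// cn_gt0.
  by apply: sumr_ge0 => l _; rewrite exprn_ge0// cn_ge0.
pose q (x : R) : R := cn (y x) ^+ 2 / N x.
have dq (x : R) : 0 < x -> is_derive x (1 : R) q 0.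
  move=> x0; have [l dl] := dcl _ (xt0 x x0).
  have dck k : rder (fun x => c k (0 + x%:C%C * t)) x (l * t * c k (0 + x%:C%C * t)).
    apply: rder_eq (rder_slice (hc k _)) _.
    by rewrite !add0r dl; ring.
  have dy : rder y x (l * t * y x).
    by apply: rder_eq (rderB (rderZ _ (dck j)) (rderZ _ (dck i))) _; rewrite /y; ring.
  (* When [u' = l * t * u], the squared modulus has logarithmic derivative [2 Re (l * t)],
     independent of [u]. Numerator and denominator of [q] share it, so [q] is constant. *)
  have mu (u : Cc R) : 2 * (complex.Re u * complex.Re (l * t * u)
      + complex.Im u * complex.Im (l * t * u)) = 2 * complex.Re (l * t) * cn u ^+ 2.
    by rewrite cn_sqr [complex.Re (_ * u)]cReM [complex.Im (_ * u)]cImM; ring.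
  have := is_derive_div (lt0r_neq0 (N0 x x0)) (is_derive_sqrn dy)
    (is_derive_sum_fun (fun k => is_derive_sqrn (dck k))).
  rewrite mu; under eq_bigr do rewrite mu; rewrite -mulr_sumr -/(N x).
  by rewrite (_ : _ - _ = 0) ?mul0r//; ring.
have q_cst x : 0 < x <= 1 -> q 1 = q x.
  move=> /andP[x0 x1]; apply/eqP; rewrite -subr_eq0; apply/eqP.
  have [z _ ->] : exists2 z, z \in `[x, 1]%R & q 1 - q x = 0 * (1 - x).
    apply: (@MVT_segment _ _ (fun=> 0)) => //.
      move=> z /subset_itv_oo_cc; rewrite in_itv => /= /andP[xz _].
      exact/dq/(lt_le_trans x0).
    apply: derivable_within_continuous => z; rewrite in_itv => /= /andP[xz _].
    by have [] := dq z (lt_le_trans x0 xz).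
  by rewrite mul0r.
have wi0 : 0 < cn (w i) by rewrite cn_gt0.
(* Near 0, with [T = x * t], the numerator of [q] is at most
   [((cn (w i) + cn (w j)) * e * cn T) ^+ 2] and the denominator at least
   [(cn (w i) / 2 * cn T) ^+ 2]; their quotient is [B * e ^+ 2]. *)
pose B := 4 * (cn (w i) + cn (w j)) ^+ 2 / cn (w i) ^+ 2.
have B0 : 0 <= B by rewrite /B mulr_ge0 ?invr_ge0 ?sqr_ge0// mulr_ge0 ?sqr_ge0.
have q_small e : 0 < e -> e <= cn (w i) / 2 -> q 1 <= B * e ^+ 2.
  move=> e0 ew.
  have /hderP /(_ _ e0) [r1 r10 H1] := hc i 0.
  have /hderP /(_ _ e0) [r2 r20 H2] := hc j 0.
  have t0' : 0 < cn t by rewrite cn_gt0.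
  pose m := Num.min r1 r2; have m0 : 0 < m by rewrite lt_min r10.
  pose x := Num.min 1 (m / 2 / cn t).
  have x0 : 0 < x by rewrite lt_min ltr01 !divr_gt0.
  have x1 : x <= 1 by rewrite ge_min lexx.
  have xm : cn (x%:C%C * t) < m.
    rewrite cnM cn_real gtr0_norm// -ltr_pdivlMr//.
    apply: (@le_lt_trans _ _ (m / 2 / cn t)); first by rewrite ge_min lexx orbT.
    by rewrite ltr_pM2r ?invr_gt0//; lra.
  move: xm; rewrite lt_min => /andP[/H1 {}H1 /H2 {}H2].
  have xt := xt0 x x0; rewrite (q_cst x) ?x0//.
  rewrite c0 dc0 subr0 in H1; rewrite c0 dc0 subr0 in H2.
  set T := x%:C%C * t in H1 H2 xt *; have T0 : 0 < cn T by rewrite cn_gt0.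
  have y_le : cn (y x) <= (cn (w i) + cn (w j)) * (e * cn T).
    rewrite (_ : y x = w i * (c j (0 + T) - w j * T) - w j * (c i (0 + T) - w i * T)).
      apply: le_trans (cnB _ _) _; rewrite (cnM (w i)) (cnM (w j)) mulrDl.
      by apply: lerD; rewrite ler_wpM2l ?cn_ge0.
    by rewrite /y -/T; ring.
  have ci : cn (w i) / 2 * cn T <= cn (c i (0 + T)).
    have := cnB (c i (0 + T)) (c i (0 + T) - w i * T).
    rewrite opprB addrC subrK cnM.
    have : e * cn T <= cn (w i) / 2 * cn T by rewrite ler_wpM2r// ltW.
    lra.
  have N_ge : (cn (w i) / 2 * cn T) ^+ 2 <= N x.
    rewrite /N (bigD1 i)//= -/T.
    apply: (@le_trans _ _ (cn (c i (0 + T)) ^+ 2)).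
      by rewrite lerXn2r ?nnegrE ?mulr_ge0 ?divr_ge0 ?cn_ge0.
    by rewrite lerDl sumr_ge0// => k _; rewrite exprn_ge0 ?cn_ge0.
  rewrite /q ler_pdivrMr; last exact: N0.
  apply: (@le_trans _ _ (B * e ^+ 2 * (cn (w i) / 2 * cn T) ^+ 2)).
    rewrite (_ : B * _ * _ = ((cn (w i) + cn (w j)) * (e * cn T)) ^+ 2).
      by rewrite lerXn2r ?nnegrE ?mulr_ge0 ?addr_ge0 ?cn_ge0 ?(ltW e0).
    by rewrite /B; field; rewrite gt_eqF.
  by rewrite ler_wpM2l// mulr_ge0// sqr_ge0.
have q1 : q 1 <= 0.
  apply/ler_addgt0Pr => x x0; rewrite add0r.
  have B1 : 0 < B + 1 by rewrite ltr_wpDl.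
  pose e := Num.min 1 (Num.min (cn (w i) / 2) (x / (B + 1))).
  have e0 : 0 < e by rewrite lt_min ltr01 lt_min !divr_gt0.
  have e1 : e <= 1 by rewrite ge_min lexx.
  have ew : e <= cn (w i) / 2 by rewrite ge_min ge_min lexx orbT.
  have ex : e * (B + 1) <= x by rewrite -ler_pdivlMr// !ge_min lexx !orbT.
  apply: le_trans (q_small e e0 ew) _; apply: le_trans ex.
  have ee : e ^+ 2 <= e by rewrite expr2 ler_piMl// ltW.
  apply: (@le_trans _ _ ((B + 1) * e ^+ 2)); first by rewrite ler_wpM2r ?sqr_ge0// lerDl.
  by rewrite mulrC ler_wpM2r// ltW.
have : cn (y 1) ^+ 2 <= 0.
  by move: q1; rewrite /q ler_pdivrMr ?mul0r//; exact: N0.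
rewrite exprn_even_le0//= cn_eq0 /y add0r (_ : (1 : R)%:C%C = 1 :> Cc R)// mul1r.
by rewrite subr_eq0 => /eqP E; rewrite mulrC E mulrC.
Qed.

End OneVariable.

(** * The Levi matrix of the logarithm of the norm *)

Section LeviOfLogNorm.
Variables (R : realType) (n : nat).
Implicit Types (u v w a b z : Cn R n).

(** [rdot] and [idot] are the real and imaginary parts of the Hermitian product, linear in [u] and
    conjugate-linear in [v] (see [hermE]). They are kept apart because [Levi] is defined through
    real derivatives. *)
Definition rdot (u v : Cn R n) : R :=
  \sum_j (complex.Re (u 0 j) * complex.Re (v 0 j) + complex.Im (u 0 j) * complex.Im (v 0 j)).

Definition idot (u v : Cn R n) : R :=
  \sum_j (complex.Im (u 0 j) * complex.Re (v 0 j) - complex.Re (u 0 j) * complex.Im (v 0 j)).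

Definition rcurve (U : R -> Cn R n) (x : R) (d : Cn R n) :=
  forall j, rder (fun t => U t 0 j) x (d 0 j).

Lemma hnorm2E z : hnorm2 z = rdot z z.
Proof. by apply: eq_bigr => j _; rewrite !expr2. Qed.

Lemma rdotC u v : rdot u v = rdot v u.
Proof. by apply: eq_bigr => j _; rewrite mulrC [X in _ + X]mulrC. Qed.

Lemma rdot_eq0 u : (rdot u u == 0) = (u == 0).
Proof.
have sq_ge0 j : 0 <= complex.Re (u 0 j) * complex.Re (u 0 j)
    + complex.Im (u 0 j) * complex.Im (u 0 j) by rewrite addr_ge0// -expr2 sqr_ge0.
apply/eqP/eqP => [/psumr_eq0P u0|->]; last first.
  by apply: big1 => j _; rewrite mxE /= !mulr0 addr0.
apply/rowP => j; rewrite mxE; apply/eqP; rewrite -cn_eq0 -sqrf_eq0 cn_sqr !expr2.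
by rewrite u0.
Qed.

Lemma rdot_gt0 u : u != 0 -> 0 < rdot u u.
Proof.
move=> u0; rewrite lt0r rdot_eq0 u0 /=; apply: sumr_ge0 => j _.
by rewrite addr_ge0// -expr2 sqr_ge0.
Qed.

Lemma rdotiZl u v : rdot (('i%C : Cc R) *: u) v = - idot u v.
Proof.
rewrite -sumrN; apply: eq_bigr => j _.
by rewrite !mxE cReM cImM /=; ring.
Qed.

Lemma rdotiZr u v : rdot u (('i%C : Cc R) *: v) = idot u v.
Proof.
apply: eq_bigr => j _.
by rewrite !mxE cReM cImM /=; ring.
Qed.

Lemma idotiZr u v : idot u (('i%C : Cc R) *: v) = - rdot u v.
Proof.
rewrite -sumrN; apply: eq_bigr => j _.
by rewrite !mxE cReM cImM /=; ring.
Qed.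

Lemma is_derive_rdot (U V : R -> Cn R n) (x : R) d e : rcurve U x d -> rcurve V x e ->
  is_derive x (1 : R) (fun t => rdot (U t) (V t)) (rdot d (V x) + rdot (U x) e).
Proof.
move=> dU dV; rewrite /rdot -big_split /=; apply: is_derive_sum_fun => j.
have [dUr dUi] := dU j; have [dVr dVi] := dV j.
have [dm dE] := is_deriveD (is_deriveM dUr dVr) (is_deriveM dUi dVi).
by apply: DeriveDef => //; rewrite dE -![_ *: _]/(_ * _); ring.
Qed.

Variables (f : Cn R n -> Cn R n) (J : Cn R n -> 'M[Cc R]_n).
Hypothesis df : forall z v j (t : Cc R),
  is_derive t (1 : Cc R) (fun s : Cc R => f (z + s *: v) 0 j) ((v *m J (z + t *: v)) 0 j).

Lemma rcurve_f z v (x : R) :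
  rcurve (fun t => f (z + t%:C%C *: v)) x (v *m J (z + x%:C%C *: v)).
Proof.
move=> j; have E (t : R) : t%:C%C = 0 + t%:C%C * (1 : Cc R) by rewrite add0r mulr1.
have := df z v j (0 + x%:C%C * (1 : Cc R)).
move=> /(@rder_slice R (fun s : Cc R => f (z + s *: v) 0 j)); rewrite mulr1 -E.
by under [X in rder X]eq_fun do rewrite -E.
Qed.

Lemma is_derive_lnhnorm z v : f z != 0 ->
  is_derive (0 : R) (1 : R) (fun t : R => ln (hnorm (f (z + t%:C%C *: v))))
    (rdot (v *m J z) (f z) / rdot (f z) (f z)).
Proof.
move=> fz; have fz0 := rdot_gt0 fz.
have z0 : z + (0 : R)%:C%C *: v = z by rewrite (_ : _%:C%C = 0)// scale0r addr0.
pose N (t : R) := rdot (f (z + t%:C%C *: v)) (f (z + t%:C%C *: v)).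
have dN : is_derive (0 : R) (1 : R) N (2 * rdot (v *m J z) (f z)).
  have := is_derive_rdot (rcurve_f z v 0) (rcurve_f z v 0).
  by rewrite z0 (rdotC (f z) (v *m J z)) -mulr2n -[_ *+ 2]mulr_natl.
have N0 : N 0 = rdot (f z) (f z) by rewrite /N z0.
have dln : is_derive (N 0) (1 : R) (@ln R) (N 0)^-1 by apply: is_derive1_ln; rewrite N0.
have := is_derive1_comp dln dN.
rewrite N0 => dlnN.
have := is_deriveZ (2^-1) dlnN.
rewrite -![_ *: _]/(_ * _).
have -> : 2^-1 * ((rdot (f z) (f z))^-1 * (2 * rdot (v *m J z) (f z))) =
    rdot (v *m J z) (f z) / rdot (f z) (f z) by field; rewrite gt_eqF.
congr is_derive; apply/funext => t; rewrite /= /hnorm hnorm2E -/(N t).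
(* The two functions must agree at every [t], also where [f] vanishes; there both sides are 0, the
   default value of [ln]. *)
have [Nt|Nt] := ltP 0 (N t); last first.
  by rewrite ?fctE -?[_ *: _]/(_ * _) /= ler0_sqrtr// [ln (N t)]ln0// ln0// mulr0.
rewrite -[N t in LHS]sqr_sqrtr ?(ltW Nt)// expr2 lnM ?posrE ?sqrtr_gt0//.
by rewrite -![_ *: _]/(_ * _); field.
Qed.

(* The second derivatives [S] of [f] enter linearly and will cancel in the Levi
   matrix. *)
Lemma D2_lnhnorm a b z (S : Cn R n) : f z != 0 ->
  (forall j, is_derive (0 : Cc R) (1 : Cc R)
    (fun s : Cc R => (b *m J (z + s *: a)) 0 j) (S 0 j)) ->
  D2 (fun z => ln (hnorm (f z))) a b z =
  ((rdot S (f z) + rdot (b *m J z) (a *m J z)) * rdot (f z) (f z)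
    - 2 * rdot (b *m J z) (f z) * rdot (a *m J z) (f z)) / rdot (f z) (f z) ^+ 2.
Proof.
move=> fz dS.
have z0 : z + (0 : R)%:C%C *: a = z by rewrite (_ : _%:C%C = 0)// scale0r addr0.
pose p (s : R) := z + s%:C%C *: a.
have dp := rcurve_f z a 0; rewrite z0 in dp.
have dBp : rcurve (fun s => b *m J (p s)) 0 S.
  move=> j; have E (t : R) : t%:C%C = 0 + t%:C%C * (1 : Cc R) by rewrite add0r mulr1.
  have := @rder_slice R (fun s : Cc R => (b *m J (z + s *: a)) 0 j) 0 1 (S 0 j) 0.
  rewrite (_ : 0 + (0 : R)%:C%C * (1 : Cc R) = 0); last by rewrite add0r mulr1.
  move=> /(_ (dS j)); rewrite mulr1.
  by under [X in rder X]eq_fun do rewrite -E.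
have dN := is_derive_rdot dp dp.
have dB := is_derive_rdot dBp dp.
have p0 : p 0 = z by exact: z0.
rewrite -/(p _) p0 in dN dB.
have Np0 : rdot (f (p 0)) (f (p 0)) != 0 by rewrite p0 rdot_eq0.
have dq := is_derive_div (Np0 : (fun t => rdot (f (p t)) (f (p t))) 0 != 0) dB dN.
rewrite /D2.
(* The formula for the inner derivative holds where [f] does not vanish; by continuity this is a
   neighbourhood, which suffices for the outer derivative. *)
have near_eq : \forall s \near (0 : R),
    rdot (b *m J (p s)) (f (p s)) / rdot (f (p s)) (f (p s)) =
    derive1 (fun t : R => ln (hnorm (f (z + s%:C%C *: a + t%:C%C *: b)))) 0.
  have : \forall s \near (0 : R), rdot (f (p s)) (f (p s)) != 0.
    have cN : {for (0 : R), continuous (fun s => rdot (f (p s)) (f (p s)))}.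
      by apply: differentiable_continuous; apply/derivable1_diffP; case: dN.
    exact: (cvgr_neq0 _ cN Np0).
  apply: filterS => s; rewrite rdot_eq0 => fps.
  by have [_ <-] := is_derive_lnhnorm b fps; rewrite derive1E.
have [_ E] := near_eq_is_derive near_eq dq.
rewrite derive1E E p0 [rdot (f z) (a *m J z)]rdotC.
by rewrite z0; congr (_ / _); ring.
Qed.

End LeviOfLogNorm.

Local Notation ii := ('i%C : Cc _).

(** * The Levi matrix in closed form *)

Section LeviForm.
Variable R : realType.

Definition star m n (A : 'M[Cc R]_(m, n)) : 'M[Cc R]_(n, m) :=
  \matrix_(i, j) (conjc (A j i) : Cc R).

Lemma conjcE (z : Cc R) : conjc z = Complex (complex.Re z) (- complex.Im z).
Proof. by case: z. Qed.

Lemma complexP (z w : Cc R) : complex.Re z = complex.Re w ->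
  complex.Im z = complex.Im w -> z = w.
Proof. by case: z w => a b [c d] /= -> ->. Qed.

Lemma conjcD (z w : Cc R) : conjc (z + w) = conjc z + conjc w :> Cc R.
Proof. by apply: complexP; rewrite ?cReD ?cImD !conjcE ?cReD ?cImD //= opprD. Qed.

Lemma conjcM (z w : Cc R) : conjc (z * w) = conjc z * conjc w :> Cc R.
Proof. by apply: complexP; rewrite ?cReM ?cImM !conjcE ?cReM ?cImM /=; ring. Qed.

Lemma conjcN (z : Cc R) : conjc (- z) = - conjc z :> Cc R.
Proof. by apply: complexP; rewrite ?cReN ?cImN !conjcE ?cReN ?cImN. Qed.

Lemma conjc_sum I (r : seq I) (F : I -> Cc R) :
  conjc (\sum_(i <- r) F i) = \sum_(i <- r) conjc (F i) :> Cc R.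
Proof.
elim/big_rec2: _ => [|i x y _ <-]; last by rewrite conjcD.
by apply: complexP; rewrite conjcE /= ?oppr0.
Qed.

Lemma starM m n p (A : 'M[Cc R]_(m, n)) (B : 'M[Cc R]_(n, p)) :
  star (A *m B) = star B *m star A.
Proof.
apply/matrixP => i j; rewrite !mxE conjc_sum; apply: eq_bigr => k _.
by rewrite !mxE conjcM mulrC.
Qed.

Lemma starB m n (A B : 'M[Cc R]_(m, n)) : star (A - B) = star A - star B.
Proof. by apply/matrixP => i j; rewrite !mxE conjcD conjcN. Qed.

Lemma starZ m n (c : Cc R) (A : 'M[Cc R]_(m, n)) : star (c *: A) = (conjc c : Cc R) *: star A.
Proof. by apply/matrixP => i j; rewrite !mxE conjcM. Qed.

Definition herm n (u v : Cn R n) : Cc R := (u *m star v) 0 0.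

Lemma mulmx_star_herm n (u v : Cn R n) : u *m star v = (herm u v)%:M.
Proof. by rewrite [LHS]mx11_scalar. Qed.

Lemma hermE n (u v : Cn R n) : herm u v = Complex (rdot u v) (idot u v).
Proof.
rewrite /herm mxE; apply: complexP.
  rewrite (big_morph (@complex.Re R) (@cReD R) (erefl : complex.Re (0 : Cc R) = 0)).
  by apply: eq_bigr => j _; rewrite cReM mxE conjcE /=; ring.
rewrite (big_morph (@complex.Im R) (@cImD R) (erefl : complex.Im (0 : Cc R) = 0)).
by apply: eq_bigr => j _; rewrite cImM mxE conjcE /=; ring.
Qed.

Lemma idotC n (u v : Cn R n) : idot u v = - idot v u.
Proof. by rewrite -sumrN; apply: eq_bigr => j _; ring. Qed.

Lemma herm_conj n (u v : Cn R n) : herm v u = conjc (herm u v).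
Proof. by rewrite !hermE rdotC idotC. Qed.

Lemma herm_row_mul m p n (A : 'M[Cc R]_(m, n)) (B : 'M[Cc R]_(p, n)) i j :
  (A *m star B) i j = herm (row i A) (row j B).
Proof. by rewrite /herm !mxE; apply: eq_bigr => k _; rewrite !mxE. Qed.

Lemma real_complex_div4 (x : R) : x%:C%C / 4%:R = (x / 4)%:C%C :> Cc R.
Proof. by apply/eqP; rewrite [X in _ == X]rmorphM fmorphV rmorph_nat. Qed.

(* The Levi matrix of [log |f|] at a point where [f] takes the value [c] and has
   Jacobian matrix [J] (row-vector convention). *)
Definition levi_form n (c : Cn R n) (J : 'M[Cc R]_n) : 'M[Cc R]_n :=
  ((2 * rdot c c ^+ 2)^-1)%:C%C *:
    ((rdot c c)%:C%C *: (J *m star J) - (J *m star c) *m (c *m star J)).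

Lemma levi_formE n (c : Cn R n) (J : 'M[Cc R]_n) i j :
  levi_form c J i j = ((2 * rdot c c ^+ 2)^-1)%:C%C *
    ((rdot c c)%:C%C * herm (row i J) (row j J) - herm (row i J) c * herm c (row j J)).
Proof.
rewrite /levi_form; set P := J *m star J; set Q := _ *m _ *m _.
have -> : herm (row i J) c * herm c (row j J) = Q i j.
  rewrite /Q mxE big_ord1; congr (_ * _); rewrite herm_row_mul.
    by congr herm; apply/rowP => k; rewrite mxE.
  by congr herm; apply/rowP => k; rewrite mxE.
by rewrite -(herm_row_mul J J) -/P !mxE.
Qed.

Lemma rdotN1l n (u v : Cn R n) : rdot ((-1 : Cc R) *: u) v = - rdot u v.
Proof.
by rewrite -sumrN; apply: eq_bigr => j _; rewrite !mxE cReM cImM /=; ring.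
Qed.

Lemma row_ej n (J : 'M[Cc R]_n) i : ej i *m J = row i J.
Proof.
rewrite rowE; congr (_ *m _); apply/rowP => k.
by rewrite !mxE eqxx.
Qed.

(** Let [S] be the second derivative of [f] along [ej j] and [ej i]. By complex linearity the four
    terms of [Levi] involve [S], [- S], [ii *: S] and [ii *: S], the last two with opposite signs,
    so second derivatives cancel and only [J] remains. *)
Lemma Levi_lnhnorm n (f : Cn R n -> Cn R n) (J : Cn R n -> 'M[Cc R]_n) z :
  (forall (z v : Cn R n) j (t : Cc R), is_derive t (1 : Cc R)
    (fun s : Cc R => f (z + s *: v) 0 j) ((v *m J (z + t *: v)) 0 j)) ->
  (forall (a b : Cn R n) j, exists E, is_derive (0 : Cc R) (1 : Cc R)
    (fun s : Cc R => (b *m J (z + s *: a)) 0 j) E) ->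
  f z != 0 -> Levi (fun z => ln (hnorm (f z))) z = levi_form (f z) (J z).
Proof.
move=> df d2f fz; apply/matrixP => i j.
have /choice [E dE] := d2f (ej i) (ej j).
pose S : Cn R n := \row_k E k.
have iN1 : ii * ii = -1 :> Cc R by exact: sqr_i.
have dS k : is_derive (0 : Cc R) (1 : Cc R)
    (fun s : Cc R => (ej j *m J (z + s *: ej i)) 0 k) (S 0 k) by rewrite mxE.
have dSb k : is_derive (0 : Cc R) (1 : Cc R)
    (fun s : Cc R => ((ii *: ej j) *m J (z + s *: ej i)) 0 k) ((ii *: S) 0 k).
  have := hderZ (ii : Cc R) (dS k).
  rewrite [X in is_derive _ _ _ X -> _](_ : _ = (ii *: S) 0 k).
    by congr is_derive; apply/funext => s; rewrite -scalemxAl [RHS]mxE.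
  by rewrite [RHS]mxE.
have dSi (b : Cn R n) (T : Cn R n) : (forall k, is_derive (0 : Cc R) (1 : Cc R)
      (fun s : Cc R => (b *m J (z + s *: ej i)) 0 k) (T 0 k)) ->
    forall k, is_derive (0 : Cc R) (1 : Cc R)
      (fun s : Cc R => (b *m J (z + s *: (ii *: ej i))) 0 k) ((ii *: T) 0 k).
  move=> dT k.
  have h : is_derive (0 : Cc R) (1 : Cc R) (fun t : Cc R => 0 + ii * t) ii.
    exact: hder_affine.
  have dTk : is_derive ((fun t : Cc R => 0 + ii * t) 0) (1 : Cc R)
      (fun s : Cc R => (b *m J (z + s *: ej i)) 0 k) (T 0 k) by rewrite mulr0 addr0.
  have := @hder_comp R (fun t : Cc R => 0 + ii * t)
    (fun s : Cc R => (b *m J (z + s *: ej i)) 0 k) 0 ii (T 0 k) dTk h.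
  rewrite (_ : T 0 k * ii = (ii *: T) 0 k); last by rewrite mxE mulrC.
  by congr is_derive; apply/funext => s /=; rewrite add0r scalerA [ii * s]mulrC.
rewrite mxE (D2_lnhnorm df fz dS) (D2_lnhnorm df fz (dSi _ _ dSb)).
rewrite (D2_lnhnorm df fz dSb) (D2_lnhnorm df fz (dSi _ _ dS)).
rewrite -!scalemxAl !row_ej scalerA iN1 !(rdotiZl, rdotiZr, idotiZr).
rewrite rdotN1l levi_formE !hermE -(mulrA ii) !real_complex_div4.
rewrite [rdot (row i (J z)) (row j (J z))]rdotC [idot (row i (J z)) (row j (J z))]idotC.
rewrite [rdot (f z) (row j (J z))]rdotC [idot (f z) (row j (J z))]idotC.
have := lt0r_neq0 (rdot_gt0 fz); move: (rdot (f z) (f z)) => N N0.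
by apply: complexP; rewrite !(cReM, cReD, cReN, cImM, cImD, cImN) /=; field.
Qed.

End LeviForm.

(** * Null vectors of the Levi form *)

Section LeviKernel.
Variables (R : realType) (n : nat).
Implicit Types (c v w : Cn R n) (J : 'M[Cc R]_n).

Lemma herm_gt0 c : c != 0 -> herm c c != 0.
Proof.
move=> /rdot_gt0 c0; rewrite hermE; apply/eqP => /(congr1 (@complex.Re R)) /=.
by apply/eqP; rewrite gt_eqF.
Qed.

Lemma herm_real c : (rdot c c)%:C%C = herm c c :> Cc R.
Proof.
rewrite hermE; apply: complexP => //=.
by have := idotC c c; lra.
Qed.

Lemma levi_form_contract c J v :
  (v *m levi_form c J *m star v) 0 0 = ((2 * rdot c c ^+ 2)^-1)%:C%C *
    (herm c c * herm (v *m J) (v *m J) - herm (v *m J) c * herm c (v *m J)).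
Proof.
rewrite /levi_form -scalemxAr -scalemxAl mxE; congr (_ * _).
rewrite mulmxBr mulmxBl -scalemxAr -scalemxAl herm_real.
have -> : v *m (J *m star J) *m star v = (v *m J) *m star (v *m J).
  by rewrite starM !mulmxA.
have -> : v *m (J *m star c *m (c *m star J)) *m star v =
    (v *m J *m star c) *m (c *m star (v *m J)) by rewrite starM !mulmxA.
by rewrite !mulmx_star_herm -scalar_mxM !mxE /= !mulr1n.
Qed.

Lemma levi_form_null c J v : c != 0 ->
  (v *m levi_form c J *m star v) 0 0 = 0 -> exists l, v *m J = l *: c.
Proof.
move=> c0; have N0 := herm_gt0 c0; have N0' := rdot_gt0 c0.
rewrite levi_form_contract => /eqP; rewrite mulf_eq0 => /orP[|/eqP].
  rewrite -cn_eq0 cn_real normr_eq0 invr_eq0 mulf_eq0 pnatr_eq0 /= expf_eq0 /=.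
  by rewrite gt_eqF.
(* The coefficient of the orthogonal projection of [u] on [c]; by [E] the residual has norm 0. *)
set u := v *m J => E; exists (herm u c / herm c c).
have cN : conjc (herm c c) = herm c c :> Cc R by rewrite -herm_conj.
have cV : conjc (herm c c)^-1 = (herm c c)^-1 :> Cc R.
  by apply: (mulIf N0); rewrite mulVf// -{2}cN -conjcM mulVf// conjcE /= oppr0.
apply/eqP; rewrite -subr_eq0 -rdot_eq0; apply/eqP.
suff : herm (u - (herm u c / herm c c) *: c) (u - (herm u c / herm c c) *: c) = 0.
  by rewrite hermE => /(congr1 (@complex.Re R)).
rewrite {1}/herm starB starZ mulmxBl !mulmxBr -!scalemxAr -!scalemxAl !mulmx_star_herm.
rewrite !mxE /= !mulr1n conjcM cV -herm_conj.
move: E; rewrite [herm c u * _]mulrC => /eqP; rewrite subr_eq0 => /eqP E.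
move: (herm u c) (herm c u) (herm u u) (herm c c) N0 E => a b p N N0 E.
have -> : p = a * b / N by rewrite -E; field.
by field.
Qed.

(** The proportionality is written this way round to match [Theta G (k t) = t *: w], where [w] is
    the image [v *m J] of the velocity. *)
Lemma levi_form_radial c J v (t : Cc R) : c = t *: (v *m J) ->
  (v *m levi_form c J *m star v) 0 0 = 0.
Proof.
move=> ct; rewrite levi_form_contract; set u := v *m J in ct *.
suff -> : herm c c * herm u u - herm u c * herm c u = 0 by rewrite mulr0.
rewrite ct /herm starZ -!scalemxAr -!scalemxAl !mxE; ring.
Qed.

End LeviKernel.

(** * Holomorphic maps of several variables *)

Section Slices.
Variables (R : realType) (n : nat).
Implicit Types (F G : Cn R n -> Cn R n) (z v a b w : Cn R n).

Lemma mulmx_Dmx F z v : v *m Dmx F z = 'd F z v.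
Proof. exact: mul_rV_lin1. Qed.

Lemma slice_is_derive F z v j (t : Cc R) : differentiable F (z + t *: v) ->
  is_derive t (1 : Cc R) (fun s : Cc R => F (z + s *: v) 0 j) ((v *m Dmx F (z + t *: v)) 0 j).
Proof.
set p := z + t *: v => dF.
have : (fun h : Cc R => (h^-1 *: (F (h *: v + p) - F p)) 0 j) @ 0^' --> ('D_v F p) 0 j.
  exact: (cvg_comp _ _ (diff_derivable dF : derivable F p v) (@coord_continuous _ _ _ 0 j _)).
have -> : 'D_v F p = v *m Dmx F p := etrans (deriveE v dF) (esym (mulmx_Dmx F p v)).
rewrite (_ : (fun h : Cc R => _) = (fun h : Cc R => h^-1 *:
    (F (z + (h *: (1 : Cc R) + t) *: v) 0 j - F (z + t *: v) 0 j))); last first.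
  apply/funext => h; rewrite !mxE; congr (_ * (F _ _ _ - _)).
  by rewrite /p [h *: 1]mulr1 scalerDl addrCA addrA.
move=> cv; apply: DeriveDef; first by apply/cvg_ex; eexists; exact: cv.
by apply: cvg_lim => //; exact: norm_hausdorff.
Qed.

Lemma slice_bounded F z a b j : differentiable F z ->
  exists r M : R, 0 < r /\ forall s t : Cc R, cn s <= r -> cn t <= r ->
    cn (F (z + s *: a + t *: b) 0 j) <= M.
Proof.
move=> dF.
have cF : F x 0 j @[x --> z] --> F z 0 j.
  exact: (cvg_comp _ _ (differentiable_continuous dF) (@coord_continuous _ _ _ 0 j _)).
move/cvgrPdist_lt : cF => /(_ 1 ltr01) /nbhs_ballP [d /= d0 Hd].
have normE (x : Cn R n) : exists2 A : R, 0 <= A & `|x| = A%:C%C.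
  exists (complex.Re `|x|); have := normr_ge0 x; case: (`|x|) => p q.
    by rewrite lecE /= => /andP[].
  by rewrite lecE /= => /andP[/eqP -> _].
have [A A0 aA] := normE a; have [B B0 bB] := normE b.
have [e e0 de] := complex_gt0 d0.
have AB : 0 < A + B + 1 by rewrite ltr_wpDl ?addr_ge0.
exists (e / (A + B + 1)), (cn (F z 0 j) + 1); split; first exact: divr_gt0.
move=> s t sr tr; have : ball z d (z + s *: a + t *: b).
  rewrite -ball_normE /= -addrA opprD addrA subrr sub0r normrN de.
  apply: le_lt_trans (ler_normD _ _) _; rewrite !normrZ aA bB !normCc.
  rewrite -[_ * A%:C%C]rmorphM -[_ * B%:C%C]rmorphM -rmorphD ltcR.
  have sA := ler_wpM2r A0 sr; have tB := ler_wpM2r B0 tr.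
  apply: le_lt_trans (lerD sA tB) _; rewrite -mulrDr.
  by rewrite mulrAC ltr_pdivrMr// ltr_pM2l//; lra.
move=> /Hd /=; rewrite normCc [1](_ : _ = (1 : R)%:C%C)// ltcR => lt1.
rewrite -[F (_ + _) _ _](subKr (F z 0 j)); apply: le_trans (cnB _ _) _.
by rewrite lerD2l ltW.
Qed.

(** A coordinate of [F (z + s *: a + t *: b)] is entire in [s] and in [t] and bounded for small [s],
    [t], so [param_is_derive] applies. *)
Lemma Dmx_derivable F z a b j : holomorphic F -> exists E, is_derive (0 : Cc R) (1 : Cc R)
  (fun s : Cc R => (b *m Dmx F (z + s *: a)) 0 j) E.
Proof.
move=> hF; have [r [M [r0 HM]]] := slice_bounded a b j (hF z).
have := @param_is_derive R (fun s t => F (z + s *: a + t *: b) 0 j)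
  (fun s t => (a *m Dmx F (z + t *: b + s *: a)) 0 j)
  (fun s t => (b *m Dmx F (z + s *: a + t *: b)) 0 j) r M r0 _ _ HM.
case=> [t s|s t|E dE].
- have := slice_is_derive j (hF (z + t *: b + s *: a)); congr is_derive.
  by apply/funext => u; rewrite addrAC.
- exact: slice_is_derive.
exists E.
have <- : (fun s : Cc R => (b *m Dmx F (z + s *: a + 0 *: b)) 0 j) =
    (fun s : Cc R => (b *m Dmx F (z + s *: a)) 0 j).
  by apply/funext => s; rewrite scale0r addr0.
exact: dE.
Qed.

Lemma is_derive_mulmx (U : Cc R -> Cn R n) (d e : Cn R n) (A : 'M[Cc R]_n) (t : Cc R) j :
  (forall k, is_derive t (1 : Cc R) (fun s : Cc R => U s 0 k) (d 0 k)) ->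
  is_derive t (1 : Cc R) (fun s : Cc R => ((U s - e) *m A) 0 j) ((d *m A) 0 j).
Proof.
move=> dU; rewrite (_ : (fun s => _) =
    \sum_(k < n) (fun s : Cc R => A k j * (- (e 0 k) + U s 0 k))); last first.
  apply/funext => s; rewrite mxE fct_sumE; apply: eq_bigr => k _.
  by rewrite !mxE mulrC [- _ + _]addrC.
rewrite mxE (eq_bigr (fun k => A k j * d 0 k)) => [|k _]; last by rewrite mulrC.
have dk k : is_derive t (1 : Cc R)
    (fun s : Cc R => A k j * (- (e 0 k) + U s 0 k)) (A k j * d 0 k).
  exact: (@hderZ R _ _ _ _ (@hder_cstD R _ _ _ _ (dU k))).
exact: is_derive_sum.
Qed.

End Slices.

Section DiffApp.
Variables (K : numFieldType) (U V W : normedModType K).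

Lemma diff_comp_app (f : U -> V) (g : V -> W) x v :
  differentiable f x -> differentiable g (f x) ->
  'd (g \o f) x v = 'd g (f x) ('d f x v).
Proof.
move=> df dg; have E := diff_comp df dg.
exact: (congr1 (fun h : U -> W => h v) E).
Qed.

Lemma diff_id_app (x v : U) : 'd (@id U) x v = v.
Proof.
have [_ E] := is_diff_id x.
exact: (congr1 (fun h : U -> U => h v) E).
Qed.

End DiffApp.

(** * Comparison of two automorphisms along complex lines *)

Section Automorphisms.
Variables (R : realType) (n : nat).
Implicit Types (F G H K : Cn R n -> Cn R n) (z v w : Cn R n).

Lemma Dmx_comp F H v z : differentiable H z -> differentiable F (H z) ->
  v *m Dmx (F \o H) z = v *m Dmx H z *m Dmx F (H z).
Proof.
move=> dH dF; have E := diff_comp_app v dH dF.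
have E1 := mulmx_Dmx (F \o H) z v.
have E2 := congr1 (fun u : Cn R n => u *m Dmx F (H z)) (mulmx_Dmx H z v).
have E3 := mulmx_Dmx F (H z) ('d H z v).
exact: (etrans E1 (etrans E (esym (etrans E2 E3)))).
Qed.

Lemma Dmx_cancel F H v z : differentiable H z -> differentiable F (H z) ->
  cancel H F -> v *m Dmx H z *m Dmx F (H z) = v.
Proof.
move=> dH dF HK; rewrite -Dmx_comp//.
have -> : F \o H = id by apply/funext => u; exact: HK.
exact: (etrans (mulmx_Dmx id z v) (diff_id_app z v)).
Qed.

Lemma Dmx_unit F H : holomorphic F -> holomorphic H -> cancel F H -> cancel H F ->
  forall z, Dmx F z \in unitmx.
Proof.
move=> hF hH FK HK z; have : Dmx H (F z) *m Dmx F z = 1%:M.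
  apply/row_matrixP => i; rewrite !rowE mulmxA mulmx1.
  by have := Dmx_cancel (delta_mx 0 i) (hH (F z)) (hF _) HK; rewrite FK.
by move/mulmx1_unit => [].
Qed.

Lemma Theta0 F : Theta F 0 = 0.
Proof. by rewrite /Theta subrr mul0mx. Qed.

Lemma Theta_slice F z v j (t : Cc R) : holomorphic F ->
  is_derive t (1 : Cc R) (fun s : Cc R => Theta F (z + s *: v) 0 j)
    ((v *m (Dmx F (z + t *: v) *m invmx (Dmx F 0))) 0 j).
Proof.
by move=> hF; rewrite mulmxA; apply: is_derive_mulmx => k; exact: slice_is_derive.
Qed.

Lemma Levi_logTheta F z : holomorphic F -> Theta F z != 0 ->
  Levi (logTheta F) z = levi_form (Theta F z) (Dmx F z *m invmx (Dmx F 0)).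
Proof.
move=> hF Fz; apply: (@Levi_lnhnorm R n (Theta F) (fun p => Dmx F p *m invmx (Dmx F 0))) => //.
  by move=> p v j t; exact: Theta_slice.
move=> a b j; have /choice [E dE] := Dmx_derivable z a b ^~ hF.
exists (((\row_k E k) *m invmx (Dmx F 0)) 0 j).
have := @is_derive_mulmx R n (fun s : Cc R => b *m Dmx F (z + s *: a)) (\row_k E k) 0
  (invmx (Dmx F 0)) 0 j.
rewrite (_ : (fun s : Cc R => (b *m (Dmx F (z + s *: a) *m invmx (Dmx F 0))) 0 j) =
  (fun s : Cc R => ((b *m Dmx F (z + s *: a) - 0) *m invmx (Dmx F 0)) 0 j)).
  by apply=> k; rewrite mxE.
by apply/funext => s; rewrite subr0 mulmxA.
Qed.

(** The point [K (G 0 + t *: (w *m Dmx G 0))] is the preimage of [t *: w] under [Theta G], and [h]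
    is the [alpha] of the overview. The hypotheses are symmetric in the two automorphisms, so the
    lemma can be used in both directions. *)
Lemma radial F H G K w : holomorphic F -> holomorphic H -> cancel F H -> cancel H F ->
  holomorphic G -> holomorphic K -> cancel G K -> cancel K G ->
  Dmx F 0 = Dmx G 0 ->
  (forall z, z != 0 -> Levi (logTheta F) z = Levi (logTheta G) z) ->
  w != 0 ->
  exists h dh, [/\ entire h dh, h 0 = 0, dh 0 = 1 &
    forall t, Theta F (K (G 0 + t *: (w *m Dmx G 0))) = h t *: w].
Proof.
move=> hF hH FK HK hG hK GK KG DFG levi w0.
pose A := invmx (Dmx G 0); pose u := w *m Dmx G 0.
have GU : Dmx G 0 \in unitmx := Dmx_unit hG hK GK KG 0.
have FU : Dmx F 0 \in unitmx by rewrite DFG.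
pose p (t : Cc R) := G 0 + t *: u; pose k t := K (p t).
have uA : u *m A = w := mulmxK GU w.
have Gk t : Theta G (k t) = t *: w.
  have -> : Theta G (k t) = (G (k t) - G 0) *m A by [].
  have -> : G (k t) - G 0 = t *: u by rewrite KG [p t]addrC addrK.
  by rewrite -scalemxAl uA.
have k0 : k 0 = 0 by rewrite /k /p scale0r addr0 GK.
have k_neq0 t : t != 0 -> k t != 0.
  apply: contra_neq => kt; have := Gk t; rewrite kt Theta0 => /esym/eqP.
  by rewrite scaler_eq0 (negPf w0) orbF => /eqP.
have F_neq0 z : z != 0 -> Theta F z != 0.
  apply: contra_neq => Fz.
  have FE : Theta F z *m Dmx F 0 = F z - F 0 := mulmxKV FU (F z - F 0).
  move: FE; rewrite Fz mul0mx => /esym/eqP; rewrite subr_eq0 => /eqP /(congr1 H).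
  by rewrite (FK z) (FK 0).
pose v t := u *m Dmx K (p t).
pose c j t := Theta F (k t) 0 j.
pose dc j t := (v t *m (Dmx F (k t) *m A)) 0 j.
have hc j : entire (c j) (dc j).
  move=> t; rewrite /c /dc /A -DFG mulmxA; apply: is_derive_mulmx => l.
  have dFK : differentiable (F \o K) (p t) by exact: differentiable_comp.
  have S := slice_is_derive l (dFK : differentiable (F \o K) (G 0 + t *: u)).
  have E := Dmx_comp u (hK (p t)) (hF (K (p t))).
  exact: hder_eq S (congr1 (fun d : Cn R n => d 0 l) E).
have vG t : v t *m (Dmx G (k t) *m A) = w.
  have E : v t *m Dmx G (k t) = u := Dmx_cancel u (hK (p t)) (hG (K (p t))) KG.
  exact: etrans (mulmxA (v t) (Dmx G (k t)) A) (etrans (congr1 (mulmx^~ A) E) uA).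
have dc0 j : dc j 0 = w 0 j by rewrite /dc k0 DFG -[X in Dmx G X]k0 vG.
have [i wi] : exists i, w 0 i != 0.
  by apply/existsP; apply: contraR w0 => /existsPn w0; apply/eqP/rowP => i;
    rewrite mxE; apply/eqP; rewrite -[_ == _]negbK w0.
have c0 j : c j 0 = 0 by rewrite /c k0 Theta0 mxE.
have c_neq0 t : t != 0 -> exists j, c j t != 0.
  move=> t0; apply/existsP; apply: contraT => /existsPn cs.
  case/negP: (F_neq0 _ (k_neq0 t t0)); apply/eqP/rowP => l.
  by rewrite [RHS]mxE; apply/eqP; move: (cs l); rewrite negbK.
have dc_parallel t : t != 0 -> exists l, forall j, dc j t = l * c j t.
  move=> t0; have kt := k_neq0 t t0; have Ft := F_neq0 _ kt.
  have Gt : Theta G (k t) != 0 by rewrite Gk scaler_eq0 negb_or t0.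
  have E : levi_form (Theta F (k t)) (Dmx F (k t) *m A) =
      levi_form (Theta G (k t)) (Dmx G (k t) *m A).
    have E1 := Levi_logTheta hF Ft; rewrite DFG in E1.
    exact: etrans (esym E1) (etrans (levi _ kt) (Levi_logTheta hG Gt)).
  have Z : (v t *m levi_form (Theta G (k t)) (Dmx G (k t) *m A) *m star (v t)) 0 0 = 0.
    apply: (@levi_form_radial _ _ _ _ _ t).
    exact: etrans (Gk t) (congr1 ( *:%R t) (esym (vG t))).
  have [l El] := levi_form_null Ft
    (etrans (congr1 (fun L => (v t *m L *m star (v t)) 0 0) E) Z).
  exists l => j; have := congr1 (fun d : Cn R n => d 0 j) El.
  by move=> E2; apply: etrans E2 _; rewrite mxE.
have c_collinear := @collinear_of_derive R n c dc (fun j => w 0 j) i hc c0 dc0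
  dc_parallel c_neq0 wi.
(* The factor is read off in a coordinate where [w] does not vanish. *)
exists (fun t => (w 0 i)^-1 * c i t), (fun t => (w 0 i)^-1 * dc i t); split.
- exact: entireZ.
- by rewrite /c k0 Theta0 mxE mulr0.
- by rewrite dc0 mulVf.
move=> t; apply/rowP => j; rewrite [RHS]mxE -[LHS]/(c j t).
by apply: (mulIf wi); rewrite c_collinear; field.
Qed.

End Automorphisms.

(** Given [z], the line is spanned by [w = Theta G z]; the curve passes through [z] at [t = 1],
    where [h 1 = 1] gives the claim. *)
Lemma Theta_rigid (R : realType) (n : nat) (F H G K : Cn R n -> Cn R n) :
  holomorphic F -> holomorphic H -> cancel F H -> cancel H F ->
  holomorphic G -> holomorphic K -> cancel G K -> cancel K G ->
  Dmx F 0 = Dmx G 0 ->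
  (forall z : Cn R n, z != 0 -> Levi (logTheta F) z = Levi (logTheta G) z) ->
  forall z, Theta F z = Theta G z.
Proof.
move=> hF hH FK HK hG hK GK KG DFG levi z.
have [->|z0] := eqVneq z 0; first by rewrite !Theta0.
have GU : Dmx G 0 \in unitmx := Dmx_unit hG hK GK KG 0.
have FU : Dmx F 0 \in unitmx by rewrite DFG.
have unTheta (E : Cn R n -> Cn R n) y : Dmx E 0 \in unitmx -> E y = E 0 + Theta E y *m Dmx E 0.
  move=> EU; have -> : Theta E y *m Dmx E 0 = E y - E 0 := mulmxKV EU (E y - E 0).
  by rewrite addrC subrK.
set w := Theta G z.
have Gz := unTheta G z GU; rewrite -/w in Gz.
have w0 : w != 0.
  apply: contra_neq z0 => w0; move: Gz; rewrite w0 mul0mx addr0 => /(congr1 K).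
  by rewrite (GK z) (GK 0).
have levi' y : y != 0 -> Levi (logTheta G) y = Levi (logTheta F) y.
  by move=> y0; exact: esym (levi y y0).
have [h [dh [hh h0 dh0 hE]]] := radial hF hH FK HK hG hK GK KG DFG levi w0.
have [k [dk [hk k0 dk0 kE]]] := radial hG hK GK KG hF hH FK HK (esym DFG) levi' w0.
(* Let [y] satisfy [Theta G y = t *: w]. Then [Theta F y = h t *: w], so [y] also lies on the curve
   of [F], at parameter [h t], and [kE] gives [Theta G y = k (h t) *: w]. *)
have hK' : cancel h k.
  move=> t; have [y yE] : exists y, y = K (G 0 + t *: (w *m Dmx G 0)) by eexists.
  have Gy : G y = G 0 + t *: (w *m Dmx G 0) by rewrite yE (KG (_ + _)).
  have Gy0 : G y - G 0 = t *: (w *m Dmx G 0) by rewrite Gy [G 0 + _]addrC addrK.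
  have Thy : Theta G y = t *: w.
    have -> : Theta G y = (G y - G 0) *m invmx (Dmx G 0) by [].
    have wK : w *m Dmx G 0 *m invmx (Dmx G 0) = w := mulmxK GU w.
    have sA := scalemxAl t (w *m Dmx G 0) (invmx (Dmx G 0)).
    by rewrite Gy0 -sA wK.
  have ThFy : Theta F y = h t *: w by rewrite yE; exact: hE.
  have Fy := unTheta F y FU; rewrite ThFy in Fy.
  have Hy : H (F 0 + h t *: (w *m Dmx F 0)) = y.
    by rewrite scalemxAl -Fy (FK y).
  have := kE (h t); rewrite Hy Thy => /eqP.
  rewrite -subr_eq0 -scalerBl scaler_eq0 (negPf w0) orbF subr_eq0.
  by move=> /eqP.
have h1 := entire_automorphism hh hk hK' h0 dh0 1.
by have := hE 1; rewrite h1 !scale1r -Gz (GK z).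
Qed.

Unset Implicit Arguments.

Theorem theorem1 (R : realType) (n : nat) (F G : Cn R n -> Cn R n) :
  (1 <= n)%N ->
  biholomorphic F -> biholomorphic G ->
  F 0 = G 0 ->
  Dmx F 0 = Dmx G 0 ->
  (forall z : Cn R n, z != 0 -> Levi (logTheta F) z = Levi (logTheta G) z) ->
  F = G.
Proof.
move=> _ [H [hF hH FK HK]] [K [hG hK GK KG]] FG0 DFG levi.
apply/funext => z.
have E := Theta_rigid hF hH FK HK hG hK GK KG DFG levi z.
have FU := Dmx_unit hF hH FK HK 0; have GU := Dmx_unit hG hK GK KG 0.
have F1 : Theta F z *m Dmx F 0 = F z - F 0 := mulmxKV FU (F z - F 0).
have G1 : Theta G z *m Dmx G 0 = G z - G 0 := mulmxKV GU (G z - G 0).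
have : F z - F 0 = G z - G 0.
  by rewrite -F1 -G1 -E DFG.
by rewrite FG0 => /addIr.
Qed.
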